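(* Let $(T^*Q,G,\omega,\mathbf{J},\mathcal{D},H)$ be a $\mathbf{J}$-nonholonomic regular orbit reducible Hamiltonian system with an associated $\mathbf{J}$-nonholonomic $R_o$-reduced distributional Hamiltonian system $(\mathcal{K}_{\mathcal{O}_\mu},\omega_{\mathcal{K}_{\mathcal{O}_\mu}},h_{\mathcal{K}_{\mathcal{O}_\mu}})$ with dynamical vector field $X_{\mathcal{K}_{\mathcal{O}_\mu}}$, where $\mu\in\mathfrak{g}^*$ is a regular value of the momentum map $\mathbf{J}$. Let $\gamma:Q\to T^*Q$ be a one-form on $Q$, $\lambda=\gamma\circ\pi_Q:T^*Q\to T^*Q$, and for any symplectic map $\varepsilon:T^*Q\to T^*Q$ put $X_H^{\varepsilon}=T\pi_Q\circ X_H\circ\varepsilon$, where $X_H$ is the Hamiltonian vector field of the corresponding unconstrained Hamiltonian system with symmetry and momentum map $(T^*Q,G,\omega,\mathbf{J},H)$. Assume that $\mathrm{Im}(\gamma)\subset\mathcal{M}\cap\mathbf{J}^{-1}(\mathcal{O}_\mu)$ and it is $G$-invariant, that $\varepsilon$ is also $G$-invariant and $\varepsilon(\mathbf{J}^{-1}(\mathcal{O}_\mu))\subset\mathbf{J}^{-1}(\mathcal{O}_\mu)$. Put $\bar\gamma_{\mathcal{O}_\mu}=\pi_{\mathcal{O}_\mu}\circ\gamma:Q\to\mathcal{M}_{\mathcal{O}_\mu}$, assume $\mathrm{Im}(T\bar\gamma_{\mathcal{O}_\mu})\subset\mathcal{K}_{\mathcal{O}_\mu}$, and put $\bar\lambda_{\mathcal{O}_\mu}=\pi_{\mathcal{O}_\mu}\circ\lambda:\mathbf{J}^{-1}(\mathcal{O}_\mu)\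 (\subset T^*Q)\to\mathcal{M}_{\mathcal{O}_\mu}$ and $\bar\varepsilon_{\mathcal{O}_\mu}=\pi_{\mathcal{O}_\mu}\circ\varepsilon:\mathbf{J}^{-1}(\mathcal{O}_\mu)\ (\subset T^*Q)\to\mathcal{M}_{\mathcal{O}_\mu}$. Then $\varepsilon$ and $\bar\varepsilon_{\mathcal{O}_\mu}$ satisfy the equation $$\tau_{\mathcal{K}_{\mathcal{O}_\mu}}\circ T\bar\varepsilon_{\mathcal{O}_\mu}\circ X_{h_{\mathcal{K}_{\mathcal{O}_\mu}}\circ\bar\varepsilon_{\mathcal{O}_\mu}}=T\bar\lambda_{\mathcal{O}_\mu}\circ X_H\circ\varepsilon$$ if and only if they satisfy the equation $$T\bar\gamma_{\mathcal{O}_\mu}\circ X_H^{\varepsilon}=X_{\mathcal{K}_{\mathcal{O}_\mu}}\circ\bar\varepsilon_{\mathcal{O}_\mu}$$ (the Type II Hamilton-Jacobi equation for $(\mathcal{K}_{\mathcal{O}_\mu},\omega_{\mathcal{K}_{\mathcal{O}_\mu}},h_{\mathcal{K}_{\mathcal{O}_\mu}})$). Here $X_{h_{\mathcal{K}_{\mathcal{O}_\mu}}\circ\bar\varepsilon_{\mathcal{O}_\mu}}$ is the Hamiltonian vector field of the function $h_{\mathcal{K}_{\mathcal{O}_\mu}}\circ\bar\varepsilon_{\mathcal{O}_\mu}:T^*Q\to\mathbb{R}$.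
   Context: $Q$ is a smooth manifold, $\pi_Q:T^*Q\to Q$ the projection, $T\pi_Q:TT^*Q\to TQ$ its tangent map, $\omega=dq^i\wedge dp_i$ the canonical symplectic form on $T^*Q$. $L:TQ\to\mathbb{R}$ is a hyperregular Lagrangian, i.e. its Legendre transformation (fibre derivative) $\mathcal{F}L:TQ\to T^*Q$ is a diffeomorphism, and $H:T^*Q\to\mathbb{R}$, $H(q,p)=\langle p,\dot q\rangle-L(q,\dot q)$ with $p=\mathcal{F}L(q,\dot q)$, is the corresponding Hamiltonian; the Hamiltonian vector field $X_f$ of a function $f$ on $T^*Q$ is defined by $\mathbf{i}_{X_f}\omega=\mathbf{d}f$. $\mathcal{D}\subset TQ$ is a distribution that is completely nonholonomic ($\mathcal{D}$ along with all its iterated Lie brackets spans $TQ$) and $\mathcal{D}$-regular (the restriction to $\mathcal{D}$ of the fibre Hessian of $L$ is nondegenerate everywhere). $\mathcal{M}=\mathcal{F}L(\mathcal{D})\subset T^*Q$ is the constraint submanifold and $\mathcal{F}=(T\pi_Q)^{-1}(\mathcal{D})\subset TT^*Q$, a distribution along $\mathcal{M}$. It is also assumed that $\dim\mathcal{M}=\operatorname{rank}\mathcal{F}$ and $T\mathcal{M}\cap\mathcal{F}^{\perp}=\{0\}$ ($\perp$: symplectic orthogonal for $\omega$). A Lie group $G$ (with Lie algebra $\mathfrak{g}$) acts smoothly on the left on $Q$; the cotangent lifted action on $T^*Q$ is free, proper and symplectic and admits an $\operatorname{Ad}^*$-equivariant momentum map $\mathbf{J}:T^*Q\to\mathfrak{g}^*$.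 $H$ and $\mathcal{D}$ are $G$-invariant, and $\mathcal{M}$ is $G$-invariant. For a regular value $\mu\in\mathfrak{g}^*$ of $\mathbf{J}$, $\mathcal{O}_\mu=G\cdot\mu\subset\mathfrak{g}^*$ is the coadjoint orbit through $\mu$, $i_{\mathcal{O}_\mu}:\mathbf{J}^{-1}(\mathcal{O}_\mu)\to T^*Q$ the inclusion, $\pi_{\mathcal{O}_\mu}:\mathbf{J}^{-1}(\mathcal{O}_\mu)\to(T^*Q)_{\mathcal{O}_\mu}=\mathbf{J}^{-1}(\mathcal{O}_\mu)/G$ the projection, and $\omega_{\mathcal{O}_\mu}$ the regular orbit reduced symplectic form, uniquely characterized by $i_{\mathcal{O}_\mu}^*\omega=\pi_{\mathcal{O}_\mu}^*\omega_{\mathcal{O}_\mu}+\mathbf{J}_{\mathcal{O}_\mu}^*\omega_{\mathcal{O}_\mu}^{+}$, where $\mathbf{J}_{\mathcal{O}_\mu}=\mathbf{J}\circ i_{\mathcal{O}_\mu}$ and $\omega_{\mathcal{O}_\mu}^{+}(\nu)(\xi_{\mathfrak{g}^*}(\nu),\eta_{\mathfrak{g}^*}(\nu))=\langle\nu,[\xi,\eta]\rangle$ for $\nu\in\mathcal{O}_\mu$, $\xi,\eta\in\mathfrak{g}$. $h_{\mathcal{O}_\mu}:(T^*Q)_{\mathcal{O}_\mu}\to\mathbb{R}$ is defined by $h_{\mathcal{O}_\mu}\circ\pi_{\mathcal{O}_\mu}=H\circ i_{\mathcal{O}_\mu}$. It is assumed that $\mathcal{M}$ intersects $\mathbf{J}^{-1}(\mathcal{O}_\mu)$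 cleanly with $\mathcal{M}\cap\mathbf{J}^{-1}(\mathcal{O}_\mu)\neq\emptyset$, so that $\mathcal{M}_{\mathcal{O}_\mu}=(\mathcal{M}\cap\mathbf{J}^{-1}(\mathcal{O}_\mu))/G\subset(T^*Q)_{\mathcal{O}_\mu}$ is a smooth manifold and $\pi_{\mathcal{O}_\mu}:\mathcal{M}\cap\mathbf{J}^{-1}(\mathcal{O}_\mu)\to\mathcal{M}_{\mathcal{O}_\mu}$ a surjective submersion. Let $\omega_{\mathcal{M}_{\mathcal{O}_\mu}}$ be the pullback of $\omega_{\mathcal{O}_\mu}$ to $\mathcal{M}_{\mathcal{O}_\mu}$, $\mathcal{F}_{\mathcal{O}_\mu}=T\pi_{\mathcal{O}_\mu}(T(\mathbf{J}^{-1}(\mathcal{O}_\mu))\cap\mathcal{F})$ the pushed-down distribution along $\mathcal{M}_{\mathcal{O}_\mu}$, and $\mathcal{K}_{\mathcal{O}_\mu}=\mathcal{F}_{\mathcal{O}_\mu}\cap T\mathcal{M}_{\mathcal{O}_\mu}$. It is assumed that $\dim\mathcal{M}_{\mathcal{O}_\mu}=\operatorname{rank}\mathcal{F}_{\mathcal{O}_\mu}$ and $T\mathcal{M}_{\mathcal{O}_\mu}\cap\mathcal{F}_{\mathcal{O}_\mu}^{\perp}=\{0\}$ ($\perp$ with respect to $\omega_{\mathcal{O}_\mu}$) and that the fibrewise restriction $\omega_{\mathcal{K}_{\mathcal{O}_\mu}}$ of $\omega_{\mathcal{M}_{\mathcal{O}_\mu}}$ to $\mathcal{K}_{\mathcal{O}_\mu}$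 is non-degenerate. $\mathbf{d}h_{\mathcal{K}_{\mathcal{O}_\mu}}$ is the restriction to $\mathcal{K}_{\mathcal{O}_\mu}$ of $\mathbf{d}(h_{\mathcal{O}_\mu}|_{\mathcal{M}_{\mathcal{O}_\mu}})$, and $X_{\mathcal{K}_{\mathcal{O}_\mu}}$ is the $\mathcal{K}_{\mathcal{O}_\mu}$-valued vector field on $\mathcal{M}_{\mathcal{O}_\mu}$ with $\mathbf{i}_{X_{\mathcal{K}_{\mathcal{O}_\mu}}}\omega_{\mathcal{K}_{\mathcal{O}_\mu}}=\mathbf{d}h_{\mathcal{K}_{\mathcal{O}_\mu}}$. The triple $(\mathcal{K}_{\mathcal{O}_\mu},\omega_{\mathcal{K}_{\mathcal{O}_\mu}},h_{\mathcal{K}_{\mathcal{O}_\mu}})$ is the $\mathbf{J}$-nonholonomic $R_o$-reduced (''regular orbit reduced'') distributional Hamiltonian system. Conventions: a symplectic map is a smooth $\varepsilon$ with $\varepsilon^*\omega=\omega$; it is $G$-invariant if it commutes with the lifted $G$-action. $G$-invariance of $\mathrm{Im}(\gamma)$ is equivalent to $\gamma(gq)=g\cdot\gamma(q)$. $\tau_{\mathcal{K}_{\mathcal{O}_\mu}}:T(T^*Q)_{\mathcal{O}_\mu}|_{\mathcal{M}_{\mathcal{O}_\mu}}\to\mathcal{K}_{\mathcal{O}_\mu}$ is the projection onto $\mathcal{K}_{\mathcal{O}_\mu}$ along the symplectic orthogonal of $\mathcal{K}_{\mathcal{O}_\mu}$ with respect to $\omega_{\mathcal{O}_\mu}$ (identity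 on $\mathcal{K}_{\mathcal{O}_\mu}$). In $h_{\mathcal{K}_{\mathcal{O}_\mu}}\circ\bar\varepsilon_{\mathcal{O}_\mu}$, $h_{\mathcal{K}_{\mathcal{O}_\mu}}$ is represented by $h_{\mathcal{O}_\mu}$, and the function is regarded as a function on $T^*Q$ via $H\circ\varepsilon$, which equals $h_{\mathcal{O}_\mu}\circ\bar\varepsilon_{\mathcal{O}_\mu}$ on $\mathbf{J}^{-1}(\mathcal{O}_\mu)$. The two equations are equations at the points $z\in\mathbf{J}^{-1}(\mathcal{O}_\mu)$; $T\bar\lambda_{\mathcal{O}_\mu}$ denotes $T(\pi_{\mathcal{O}_\mu}\circ\lambda)$. *)

(* Defs.v *)
(* Real analysis over an arbitrary [R : realType].

   Manifolds are set up by charts.  An atlas comes with a preferred chart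
   [chart a] around each point [a]; the tangent space at [a] is the model space
   ['rV[R]_n], a tangent vector being given by its components in the preferred
   chart at its base point.  Likewise a covector at [a] is given by its
   components in the coordinate cobasis of [chart a].  An element of the total
   space of a (co)tangent bundle is a pair (base point, components).  Every
   smooth manifold has such a presentation, and no notion below depends on which
   charts are preferred.                                                      *)
From HB Require Import structures.
From mathcomp Require Import all_boot all_order all_algebra.
From mathcomp Require Import all_classical all_reals all_analysis.

Set Implicit Arguments.
Unset Strict Implicit.
Unset Printing Implicit Defensive.

Import Order.TTheory GRing.Theory Num.Theory.
Import numFieldNormedType.Exports.

Local Open Scope classical_set_scope.
Local Open Scope ring_scope.

(* For finite-dimensional [V]: class C^k on an open set [U]. *)
Fixpoint Ck (R : realType) (V W : normedModType R) (k : nat) (U : set V)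
    (f : V -> W) : Prop :=
  if k is k'.+1 then
    (forall x, U x -> differentiable f x) /\
    (forall v, Ck k' U (fun x => 'D_v f x))
  else forall x, U x -> {for x, continuous f}.

Definition Cinf (R : realType) (V W : normedModType R) (U : set V)
    (f : V -> W) : Prop := forall k, Ck k U f.

Definition dot (R : realType) (n : nat) (p v : 'rV[R]_n) : R :=
  \sum_i p 0 i * v 0 i.

Definition subspace_dim (R : realType) (n : nat) (A : set 'rV[R]_n) (k : nat) :
    Prop :=
  exists2 V : {vspace 'rV[R]_n}, A = [set` V] & \dim V = k.

(* [param a] is the inverse of [chart a], meaningful on the image of [cdom a].
   An [mfd] is only raw data; the axioms are in [is_manifold]. *)
Record atlas (R : realType) (T : Type) := Atlas {
  adim : nat;
  acdom : T -> set T;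
  achart : T -> T -> 'rV[R]_adim;
  aparam : T -> 'rV[R]_adim -> T }.

Record mfd (R : realType) := Mfd {
  pts :> Type;
  matlas : atlas R pts }.

Definition mdim (R : realType) (M : mfd R) : nat := adim (matlas M).

Notation tvec M := 'rV_(mdim M).

Section Charts.
Context {R : realType}.
Implicit Types M N S P : mfd R.

Definition cdom M : M -> set M := @acdom R M (matlas M).
Definition chart M : M -> M -> 'rV[R]_(mdim M) := @achart R M (matlas M).
Definition param M : M -> 'rV[R]_(mdim M) -> M := @aparam R M (matlas M).

(* the topology for which all charts are homeomorphisms *)
Definition mopen M (A : set M) : Prop :=
  forall x, A x -> nbhs (chart x x) (param x @^-1` A).

Lemma mopenT M : mopen [set: M].
Proof. by move=> x _; exact: filterT. Qed.

Lemma mopenI M : setI_closed (@mopen M).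
Proof.
by move=> A B oA oB x [Ax Bx]; apply: filterI; [exact: oA|exact: oB].
Qed.

Lemma mopen_bigU M (I : Type) (F : I -> set M) :
  (forall i, mopen (F i)) -> mopen (\bigcup_i F i).
Proof.
move=> oF x [i _ Fix]; apply: filterS (oF i x Fix) => u Fu; by exists i.
Qed.

HB.instance Definition _ M := gen_eqMixin (pts M).
HB.instance Definition _ M := gen_choiceMixin (pts M).
HB.instance Definition _ M :=
  isOpenTopological.Build (pts M) (@mopenT M) (@mopenI M) (@mopen_bigU M).

Definition is_manifold M : Prop :=
  [/\ forall a : M, cdom a a,
      forall a x : M, cdom a x -> param a (chart a x) = x,
      forall a b : M, open (chart a @` (cdom a `&` cdom b)),
      forall a b : M,
        Cinf (chart a @` (cdom a `&` cdom b)) (chart b \o param a) &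
      hausdorff_space M /\ @second_countable M].

(* [U] is a coordinate neighbourhood of [a], read in the chart at [a] *)
Definition coord_nbhs M (a : M) (U : set 'rV[R]_(mdim M)) : Prop :=
  [/\ open U, U (chart a a) & U `<=` chart a @` cdom a].

Definition smooth M N (f : M -> N) : Prop :=
  forall a : M, exists U, [/\ coord_nbhs a U,
    forall u, U u -> cdom (f a) (f (param a u)) &
    Cinf U (chart (f a) \o f \o param a)].

Definition smoothv M (W : normedModType R) (f : M -> W) : Prop :=
  forall a : M, exists2 U, coord_nbhs a U & Cinf U (f \o param a).

Definition dmap M (W : normedModType R) (f : M -> W) (a : M) :
    'rV[R]_(mdim M) -> W :=
  'd (f \o param a) (chart a a).

(* in components with respect to the preferred charts at [a] and [f a] *)
Definition tmap M N (f : M -> N) (a : M) :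
    'rV[R]_(mdim M) -> 'rV[R]_(mdim N) :=
  dmap (chart (f a) \o f) a.

Definition submersion M N (f : M -> N) : Prop :=
  smooth f /\ forall a w, exists v, tmap f a v = w.

Definition immersion M N (f : M -> N) : Prop :=
  smooth f /\ forall a, injective (tmap f a).

(* [i : S -> P] makes the subset [A] of [P] an initial (weakly embedded)
   submanifold.  A subset has at most one such structure.  Embedded submanifolds
   are initial, and so are preimages of coadjoint orbits under momentum maps,
   which need not be embedded. *)
Definition submanifold S P (i : S -> P) (A : set P) : Prop :=
  [/\ is_manifold S, immersion i, injective i, range i = A &
      forall (X : mfd R) (f : X -> S), is_manifold X ->
        smooth (i \o f) -> smooth f].

Definition tangent_space S P (i : S -> P) (x : S) : set 'rV[R]_(mdim P) :=
  range (tmap i x).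

(* the vector of [T_x S] identified by [T i] with a vector [v] of [T_(i x) P]
   that is tangent to the submanifold *)
Definition restr S P (i : S -> P) (x : S) (v : 'rV[R]_(mdim P)) :
    'rV[R]_(mdim S) :=
  xget 0 [set u | tmap i x u = v].

Definition prod_atlas M N : atlas R (M * N) :=
  @Atlas R (M * N) (mdim M + mdim N)
    (fun a => [set x | cdom a.1 x.1 /\ cdom a.2 x.2])
    (fun a x => row_mx (chart a.1 x.1) (chart a.2 x.2))
    (fun a u => (param a.1 (lsubmx u), param a.2 (rsubmx u))).

Definition prod_mfd M N : mfd R := Mfd (prod_atlas M N).

(* change of components at [x], from the chart at [a] to the chart at [b] *)
Definition trans M (a b x : M) : 'rV[R]_(mdim M) -> 'rV[R]_(mdim M) :=
  'd (chart b \o param a) (chart a x).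

Definition vfield M := M -> 'rV[R]_(mdim M).

(* components of [X] in the chart at [a], as functions of the coordinates *)
Definition vf_rep M (X : vfield M) (a : M) (u : 'rV[R]_(mdim M)) :
    'rV[R]_(mdim M) :=
  trans (param a u) a (param a u) (X (param a u)).

Definition smooth_vfield M (X : vfield M) : Prop :=
  forall a, exists2 U, coord_nbhs a U & Cinf U (vf_rep X a).

Definition bracket M (X Y : vfield M) : vfield M := fun x =>
  'd (vf_rep Y x) (chart x x) (X x) - 'd (vf_rep X x) (chart x x) (Y x).

Definition subbundle M (D : M -> {vspace 'rV[R]_(mdim M)}) (k : nat) : Prop :=
  forall a, exists U (X : 'I_k -> vfield M), [/\ coord_nbhs a U,
    forall i, Cinf U (vf_rep (X i) a),
    forall u, U u -> \dim (D (param a u)) = k &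
    forall u, U u ->
      D (param a u) = <<[seq X i (param a u) | i <- enum 'I_k]>>%VS].

Inductive iterated_bracket M (D : M -> {vspace 'rV[R]_(mdim M)}) :
    vfield M -> Prop :=
| ib_section X : smooth_vfield X -> (forall x, X x \in D x) ->
    iterated_bracket D X
| ib_bracket X Y : iterated_bracket D X -> iterated_bracket D Y ->
    iterated_bracket D (bracket X Y).

Definition completely_nonholonomic M (D : M -> {vspace 'rV[R]_(mdim M)}) :
    Prop :=
  forall (x : M) (v : 'rV[R]_(mdim M)),
    exists (m : nat) (X : 'I_m -> vfield M),
      (forall i, iterated_bracket D (X i)) /\
      v \in <<[seq X i x | i <- enum 'I_m]>>%VS.

Definition tangent_atlas M : atlas R (M * 'rV[R]_(mdim M)) :=
  @Atlas R (M * 'rV[R]_(mdim M)) (mdim M + mdim M)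
    (fun a => [set x | cdom a.1 x.1])
    (fun a x => row_mx (chart a.1 x.1) (trans x.1 a.1 x.1 x.2))
    (fun a u => let x := param a.1 (lsubmx u) in
                (x, trans a.1 x x (rsubmx u))).

Definition tangent M : mfd R := Mfd (tangent_atlas M).

(* change of components of covectors: transpose of [trans b a x] *)
Definition cotrans M (a b x : M) (p : 'rV[R]_(mdim M)) : 'rV[R]_(mdim M) :=
  \row_i dot p (trans b a x (delta_mx 0 i)).

(* The chart at [(q, p)] is the canonical chart (q^i, p_i) induced by the chart
   of the base at [q]. *)
Definition cotangent_atlas M : atlas R (M * 'rV[R]_(mdim M)) :=
  @Atlas R (M * 'rV[R]_(mdim M)) (mdim M + mdim M)
    (fun a => [set x | cdom a.1 x.1])
    (fun a x => row_mx (chart a.1 x.1) (cotrans x.1 a.1 x.1 x.2))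
    (fun a u => let x := param a.1 (lsubmx u) in
                (x, cotrans a.1 x x (rsubmx u))).

Definition cotangent M : mfd R := Mfd (cotangent_atlas M).

Definition cotangent_proj M : cotangent M -> M := fst.

(* omega = dq^i /\ dp_i *)
Definition omega M (z : cotangent M) (v w : 'rV[R]_(mdim M + mdim M)) : R :=
  dot (lsubmx v) (rsubmx w) - dot (lsubmx w) (rsubmx v).

Definition symplectic_map M (f : cotangent M -> cotangent M) : Prop :=
  smooth f /\ forall z v w,
    omega (f z) (tmap f z v) (tmap f z w) = omega z v w.

Definition hamiltonian_vfield M (f : cotangent M -> R)
    (X : vfield (cotangent M)) : Prop :=
  forall z v, omega z (X z) v = dmap f z v.

Definition one_form M (g : M -> cotangent M) : Prop :=
  smooth g /\ forall q, cotangent_proj (g q) = q.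

Definition legendre M (L : tangent M -> R) (x : tangent M) : cotangent M :=
  (x.1, \row_i 'd (fun v : 'rV[R]_(mdim M) => L (x.1, v)) (x.2) (delta_mx 0 i)).

Definition hyperregular M (L : tangent M -> R) : Prop :=
  smooth (legendre L) /\
  exists G : cotangent M -> tangent M,
    [/\ smooth G, cancel (legendre L) G & cancel G (legendre L)].

Definition hamiltonian_of M (L : tangent M -> R) (H : cotangent M -> R) :
    Prop :=
  smoothv H /\
  forall x : tangent M, H (legendre L x) = dot (legendre L x).2 x.2 - L x.

Definition fibre_hessian M (L : tangent M -> R) (x : tangent M)
    (u w : 'rV[R]_(mdim M)) : R :=
  let l := fun v : 'rV[R]_(mdim M) => L (x.1, v) in 'D_u (fun v => 'D_w l v) (x.2).

Definition D_regular M (L : tangent M -> R)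
    (D : M -> {vspace 'rV[R]_(mdim M)}) : Prop :=
  forall (x : tangent M) u, x.2 \in D x.1 -> u \in D x.1 ->
    (forall w, w \in D x.1 -> fibre_hessian L x u w = 0) -> u = 0.

Definition constraint_set M (L : tangent M -> R)
    (D : M -> {vspace 'rV[R]_(mdim M)}) : set (cotangent M) :=
  [set legendre L x | x in [set x : tangent M | x.2 \in D x.1]].

End Charts.

Record lie_group (R : realType) := LieGroup {
  lg_grp :> groupType;
  lg_atlas : atlas R lg_grp }.

Section LieGroups.
Context {R : realType}.
Local Open Scope group_scope.
Implicit Types (G : lie_group R) (Q : mfd R).

Definition lg_mfd G : mfd R := Mfd (lg_atlas G).

Definition is_lie_group G : Prop :=
  [/\ is_manifold (lg_mfd G),
      smooth (fun g : prod_mfd (lg_mfd G) (lg_mfd G) =>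
                g.1 * g.2 : lg_mfd G) &
      smooth (fun g : lg_mfd G => g^-1 : lg_mfd G)].

Definition lie_alg G := 'rV[R]_(mdim (lg_mfd G)).

(* The dual of the Lie algebra, in the dual basis; the pairing is [dot]. *)
Definition lie_dual G := 'rV[R]_(mdim (lg_mfd G)).

Definition left_inv G (xi : lie_alg G) : vfield (lg_mfd G) := fun g =>
  tmap (fun h : lg_mfd G => g * h : lg_mfd G) 1 xi.

Definition lie_bracket G (xi eta : lie_alg G) : lie_alg G :=
  bracket (left_inv xi) (left_inv eta) 1.

Definition Ad G (g : G) (xi : lie_alg G) : lie_alg G :=
  tmap (fun h : lg_mfd G => g * h * g^-1 : lg_mfd G) 1 xi.

(* the left action Ad^*_{g^-1} of the group on the dual of its Lie algebra *)
Definition coAd G (g : G) (nu : lie_dual G) : lie_dual G :=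
  \row_i dot nu (Ad g^-1 (delta_mx 0 i : lie_alg G)).

Definition coadjoint_orbit G (mu : lie_dual G) : set (lie_dual G) :=
  range (fun g : G => coAd g mu).

Definition coad_generator G (xi : lie_alg G) (nu : lie_dual G) : lie_dual G :=
  dmap (fun g : lg_mfd G => coAd g nu) 1 xi.

Definition orbit_tangent G (nu : lie_dual G) : set (lie_dual G) :=
  range (fun xi : lie_alg G => coad_generator xi nu).

(* [op nu], on the tangent space of the orbit of [mu] at [nu], is the (+)-orbit
   symplectic form *)
Definition orbit_form G (mu : lie_dual G)
    (op : lie_dual G -> lie_dual G -> lie_dual G -> R) : Prop :=
  forall nu, coadjoint_orbit mu nu -> forall xi eta : lie_alg G,
    op nu (coad_generator xi nu) (coad_generator eta nu) =
    dot nu (lie_bracket xi eta).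

Definition smooth_left_action G Q (act : G -> Q -> Q) : Prop :=
  [/\ forall q, act 1 q = q,
      forall g h q, act (g * h) q = act g (act h q) &
      smooth (fun x : prod_mfd (lg_mfd G) Q => act x.1 x.2)].

Definition cotangent_lift G Q (act : G -> Q -> Q) (g : G) (z : cotangent Q) :
    cotangent Q :=
  (act g z.1, \row_i dot z.2 (tmap (act g^-1) (act g z.1) (delta_mx 0 i))).

Definition free_action G Q (act : G -> Q -> Q) : Prop :=
  forall g q, act g q = q -> g = 1.

Definition proper_action G Q (act : G -> Q -> Q) : Prop :=
  forall K : set (Q * Q), compact K ->
    compact [set x : lg_mfd G * Q | K (act x.1 x.2, x.2)].

Definition generator G Q (act : G -> Q -> Q) (xi : lie_alg G) : vfield Q :=
  fun q => tmap (fun g : lg_mfd G => act g q) 1 xi.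

(* smooth [J] with the generator of [xi] equal to the Hamiltonian vector field
   of the component of [J] along [xi] *)
Definition momentum_map G Q (act : G -> cotangent Q -> cotangent Q)
    (J : cotangent Q -> lie_dual G) : Prop :=
  smoothv J /\
  forall xi : lie_alg G,
    hamiltonian_vfield (fun z => dot (J z) xi) (generator act xi).

Definition equivariant G Q (act : G -> cotangent Q -> cotangent Q)
    (J : cotangent Q -> lie_dual G) : Prop :=
  forall g z, J (act g z) = coAd g (J z).

Definition regular_value G Q (J : cotangent Q -> lie_dual G)
    (mu : lie_dual G) : Prop :=
  forall z, J z = mu -> forall nu, exists v, dmap J z v = nu.

End LieGroups.

Section Reduction.
Context {R : realType}.
Implicit Types (G : lie_group R) (Q N B C S : mfd R).

Definition symp_orth (n : nat) (form : 'rV[R]_n -> 'rV[R]_n -> R)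
    (A : set 'rV[R]_n) : set 'rV[R]_n :=
  [set v | forall w, A w -> form v w = 0].

Definition constraint_dist Q (D : Q -> {vspace 'rV[R]_(mdim Q)})
    (z : cotangent Q) : set 'rV[R]_(mdim (cotangent Q)) :=
  [set v | tmap (@cotangent_proj R Q) z v \in D (cotangent_proj z)].

(* [iN] presents J^-1(O_mu) as a submanifold.  The condition on tangent spaces
   says that it is the (transverse) preimage of the immersed submanifold O_mu. *)
Definition orbit_level G Q (J : cotangent Q -> lie_dual G) (mu : lie_dual G)
    N (iN : N -> cotangent Q) : Prop :=
  submanifold iN (J @^-1` coadjoint_orbit mu) /\
  forall x, tangent_space iN x =
    [set v | orbit_tangent (J (iN x)) (dmap J (iN x) v)].

(* [piO] presents [B] as the quotient manifold of [N] by the group, which acts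
   on [N] through its inclusion [iN] *)
Definition orbit_quotient G Q (act : G -> cotangent Q -> cotangent Q)
    N (iN : N -> cotangent Q) B (piO : N -> B) : Prop :=
  [/\ is_manifold B, submersion piO, range piO = setT &
      forall x y, piO x = piO y <-> exists g, iN y = act g (iN x)].

(* i^* omega = pi^* omegaO + J_O^* omega^+.  As [piO] is a surjective submersion,
   this identity determines [omegaO], hence its being a symplectic form. *)
Definition reduced_form G Q (J : cotangent Q -> lie_dual G)
    (op : lie_dual G -> lie_dual G -> lie_dual G -> R) N (iN : N -> cotangent Q) B (piO : N -> B)
    (omegaO : B -> 'rV[R]_(mdim B) -> 'rV[R]_(mdim B) -> R) : Prop :=
  forall x v w,
    omega (iN x) (tmap iN x v) (tmap iN x w) =
    omegaO (piO x) (tmap piO x v) (tmap piO x w) +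
    op (J (iN x)) (dmap (J \o iN) x v) (dmap (J \o iN) x w).

(* [jC] presents the intersection of [N] with the submanifold [S] of the
   cotangent bundle as a submanifold of [N] *)
Definition clean_intersection Q N (iN : N -> cotangent Q)
    S (iS : S -> cotangent Q) C (jC : C -> N) : Prop :=
  submanifold jC (iN @^-1` range iS) /\
  forall c s, iN (jC c) = iS s ->
    tangent_space (iN \o jC) c =
    tangent_space iN (jC c) `&` tangent_space iS s.

(* In the following [jO : S -> B] is the inclusion of the reduced constraint
   manifold [S], and [piS : C -> S] the projection of the constraint set [C] of
   [N]. *)

Definition reduced_dist Q (D : Q -> {vspace 'rV[R]_(mdim Q)})
    N (iN : N -> cotangent Q) B (piO : N -> B) C (jC : C -> N)
    S (piS : C -> S) (y : S) : set 'rV[R]_(mdim B) :=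
  [set w | exists (c : C) (v : 'rV[R]_(mdim N)),
     [/\ piS c = y,
         constraint_dist D (iN (jC c)) (tmap iN (jC c) v) &
         tmap piO (jC c) v = w]].

(* The intersection of [reduced_dist] with TS, as a set of vectors of TS. *)
Definition reduced_K Q (D : Q -> {vspace 'rV[R]_(mdim Q)})
    N (iN : N -> cotangent Q) B (piO : N -> B) C (jC : C -> N)
    S (piS : C -> S) (jO : S -> B) (y : S) : set 'rV[R]_(mdim S) :=
  [set u | reduced_dist D iN piO jC piS y (tmap jO y u)].

Definition pullback_form B S (jO : S -> B)
    (form : B -> 'rV[R]_(mdim B) -> 'rV[R]_(mdim B) -> R)
    (y : S) (u v : 'rV[R]_(mdim S)) : R :=
  form (jO y) (tmap jO y u) (tmap jO y v).

(* [X] takes values in [K] and i_X omegaK = dh_K *)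
Definition distributional_vfield S (K : forall y : S, set 'rV[R]_(mdim S))
    (form : S -> 'rV[R]_(mdim S) -> 'rV[R]_(mdim S) -> R) (h : S -> R)
    (X : vfield S) : Prop :=
  forall y, K y (X y) /\ forall u, K y u -> form y (X y) u = dmap h y u.

(* [tau y] is the projection of [T_(jO y) B] onto [K y], regarded as a subspace
   of it by [tmap jO y], along the [form]-orthogonal of [K y] *)
Definition projection_along_orth B S (jO : S -> B)
    (form : B -> 'rV[R]_(mdim B) -> 'rV[R]_(mdim B) -> R)
    (K : forall y : S, set 'rV[R]_(mdim S))
    (tau : forall y : S, 'rV[R]_(mdim B) -> 'rV[R]_(mdim S)) : Prop :=
  forall y w, K y (tau y w) /\
    symp_orth (form (jO y)) (tmap jO y @` K y) (w - tmap jO y (tau y w)).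

End Reduction.

(* Main.v *)
Require Import Defs.
From HB Require Import structures.
From mathcomp Require Import all_boot all_order all_algebra.
From mathcomp Require Import all_classical all_reals all_analysis.

(** Write [z = eps (iN x)].  Since [iN] and [jO] are injective,
    [lambdabar = gammabar \o pi_Q \o iN].  By the chain rule the vector
    [T lambdabar (X_H z)] is therefore [T gammabar (T pi_Q (X_H z))], and it sits
    over the point [gammabar (pi_Q z)]: the first equation has the left-hand side
    of the second on its right.  So the theorem amounts to the fact that the
    left-hand side of the first equation at [x] is, for every [eps] as in the
    hypotheses, the vector [X_K] at [epsbar x].

    To see this, note first that [eps] is symplectic, so that its tangent maps
    are bijective, and carries the Hamiltonian vector field of [H \o eps] to that
    of [H] ([symplectic_map_vfield]).  Next, [H] and [H \o eps] are
    invariant, so [T J] kills both fields ([momentum_conserved]); they are tangent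
    to the level set [N], and the orbit term in the identity characterizing the
    reduced form vanishes on them.  That identity then says that the projection of
    [X_H] to the quotient is the Hamiltonian vector of [ham] for the reduced
    form ([reduced_hamiltonian]).  Finally, projecting the Hamiltonian vector of
    [ham] onto [K] along the orthogonal of [K] gives an element of [K] that
    represents the restriction of [d ham] to [K]; since the form is nondegenerate
    on [K], it is [X_K] ([projected_hamiltonian_vector]).

    The work lies in the calculus behind these steps.  The maps
    [gammabar] and [epsbar] are only known through their composites with
    immersions, and are smooth by the universal property of initial submanifolds;
    this needs closure of C^k maps under composition ([Ck_comp]).  Additivity of
    the reduced form rests on that of the Lie bracket, hence on the
    differentiability of left-invariant vector fields
    ([vf_rep_left_inv_differentiable]), and conservation of momentum rests on the
    differentiability of the orbit maps of the cotangent lift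
    ([lift_orbit_map_mdifferentiable]).  Both are obtained from the observation
    that a differential in one group of variables of a smooth map depends
    differentiably on the base point ([diff_partial]). *)

Import Order.TTheory GRing.Theory Num.Theory.
Import numFieldNormedType.Exports.
Local Open Scope classical_set_scope.
Local Open Scope ring_scope.

Set Implicit Arguments.
Unset Strict Implicit.
Unset Printing Implicit Defensive.

(** * Differentials and C^k maps between normed spaces *)

Lemma subrACA (V : zmodType) (a b c d : V) :
  (a - b) - (c - d) = (a - c) - (b - d).
Proof. by rewrite !opprD !opprK addrACA. Qed.

Section Calculus.
Context {R : realType}.
Implicit Types V W : normedModType R.

(** The differential is local.  It is needed because expressions in coordinates
    agree only where the charts are defined. *)
Lemma near_eq_diff V W (f g : V -> W) x : {near x, f =1 g} ->
  differentiable f x -> differentiable g x /\ 'd g x = 'd f x :> (V -> W).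
Proof.
move=> fg df.
have dfc : continuous ('d f x) by exact: diff_continuous.
have gx : g \o shift x = cst (g x) + 'd f x +o_ 0 id.
  apply/eqaddoP => e e0.
  have /eqaddoP/(_ e e0) := diff_locally df.
  have : \forall h \near (0 : V), f (h + x) = g (h + x).
    move: fg; rewrite /prop_near1 near_simpl /= [X in X -> _](near_shift 0).
    by rewrite subr0.
  apply: filter_app2; near=> h => fgh.
  by rewrite !fctE /= fgh (nbhs_singleton fg).
have dg := diff_unique dfc gx.
split; last exact: dg.
by apply/diff_locallyP; rewrite dg.
Unshelve. all: by end_near. Qed.

(** The form in which the chain rule is used throughout: [h] is a composite of
    coordinate expressions only near [x], and the intermediate point [F x]
    is known under another name. *)
Lemma near_diff_comp V V' W (F : V -> V') (G : V' -> W) (h : V -> W) x y :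
  F x = y -> differentiable F x -> differentiable G y ->
  {near x, G \o F =1 h} ->
  differentiable h x /\ forall v, 'd h x v = 'd G y ('d F x v).
Proof.
move=> <- dF dG E; have [dh e] := near_eq_diff E (differentiable_comp dF dG).
by split=> // v; rewrite e diff_comp.
Qed.

(** Named so that it can carry a structure of linear map. *)
Definition rV_coord n (i : 'I_n) (u : 'rV[R]_n) : R := u 0 i.

Fact rV_coord_is_linear n i : linear (@rV_coord n i).
Proof. by move=> a u v; rewrite /rV_coord !mxE. Qed.

HB.instance Definition _ n i :=
  GRing.isLinear.Build R 'rV[R]_n R *:%R (@rV_coord n i)
    (@rV_coord_is_linear n i).

Lemma rV_sum_delta n (W : lmodType R) (f : {linear 'rV[R]_n -> W}) u :
  f u = \sum_i u 0 i *: f (delta_mx 0 i).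
Proof.
rewrite [in LHS](row_sum_delta u) linear_sum.
by apply: eq_bigr => i _; rewrite linearZ.
Qed.

Lemma linear_rV_continuous n W (f : {linear 'rV[R]_n -> W}) : continuous f.
Proof.
have -> : (f : _ -> _) = fun u => \sum_i u 0 i *: f (delta_mx 0 i).
  by apply/funext => u; exact: rV_sum_delta.
move=> u; have FF : Filter (nbhs u) by exact: nbhs_filter.
apply: cvg_big => [|i _]; first exact: add_continuous.
by apply: cvgZr_tmp; exact: coord_continuous.
Qed.

(** The Leibniz rule, an instance of the differential of a bilinear map. *)
Lemma diff_scale V W (a : V -> R) (g : V -> W) x v :
  differentiable a x -> differentiable g x ->
  differentiable (fun y => a y *: g y) x /\
  'd (fun y => a y *: g y) x v = a x *: 'd g x v + 'd a x v *: g x.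
Proof.
move=> da dg.
have bil : bilinear_for (GRing.Scale.Law.clone _ _ *:%R _)
    (GRing.Scale.Law.clone _ _ *:%R _) (@GRing.scale R W : R -> W -> W).
  by split=> [u'|u] b y z /=; rewrite (scalerDl, scalerDr) !scalerA // mulrC.
pose scaleM := @bilinear_isBilinear.Build R R W W _ _ _ bil.
pose scaleL : {bilinear R -> W -> W} := HB.pack (@GRing.scale R W) scaleM.
have cs : continuous (fun p : R * W => scaleL p.1 p.2).
  exact: scale_continuous.
have ds := differentiable_bilin (a x, g x) cs.
have dp := differentiable_pair da dg.
split; first exact: (differentiable_comp dp ds).
have -> : (fun y => a y *: g y) =
  (fun p => scaleL p.1 p.2) \o (fun y => (a y, g y)) by [].
by rewrite diff_comp// diff_bilin//= diff_pair.
Qed.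

Lemma Ck_sub V W k (U U' : set V) (f : V -> W) :
  U `<=` U' -> Ck k U' f -> Ck k U f.
Proof.
move=> UU'; elim: k f => [|k IH] f /=; first by move=> h x /UU'; exact: h.
by move=> [df Df]; split => [x /UU'|v]; [exact: df|exact: IH].
Qed.

Lemma open_near_eq V W (U : set V) (f g : V -> W) x : open U ->
  (forall y, U y -> f y = g y) -> U x -> {near x, f =1 g}.
Proof. by move=> oU fg Ux; apply: filterS (open_nbhs_nbhs (conj oU Ux)). Qed.

Lemma Ck_ext V W k (U : set V) (f g : V -> W) : open U ->
  (forall x, U x -> f x = g x) -> Ck k U f -> Ck k U g.
Proof.
move=> oU; elim: k f g => [|k IH] f g fg /=.
  move=> cf x Ux; rewrite /prop_for /continuous_at -(fg x Ux).
  apply: cvg_trans (cf x Ux); apply: near_eq_cvg.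
  exact: open_near_eq Ux.
move=> [df Df]; split => [x Ux|v].
  by have [] := near_eq_diff (open_near_eq oU fg Ux) (df x Ux).
apply: IH (Df v) => x Ux; apply: near_eq_derive.
exact: open_near_eq Ux.
Qed.

Lemma CkW V W k (U : set V) (f : V -> W) : Ck k.+1 U f -> Ck k U f.
Proof.
elim: k f => [|k IH] f [df Df].
  by move=> x Ux; exact/differentiable_continuous/df.
by split => // v; exact: IH.
Qed.

Lemma Ck_cst V W k (U : set V) (c : W) : Ck k U (fun=> c).
Proof.
elim: k c => [|k IH] c /=; first by move=> x _; exact: cvg_cst.
split=> [x _|v]; first exact: differentiable_cst.
have -> : (fun x => 'D_v (fun=> c) x) = (fun=> 0 : W); last exact: IH.
by apply/funext => x; exact: derive_cst.
Qed.

Lemma Ck_linear V W k (U : set V) (f : {linear V -> W}) :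
  continuous f -> Ck k U f.
Proof.
move=> cf; case: k => [|k] /=; first by move=> x _; exact: cf.
split=> [x _|v]; first exact: linear_differentiable.
have -> : (fun x => 'D_v f x) = (fun=> f v); last exact: Ck_cst.
apply/funext => x; rewrite deriveE; last exact: linear_differentiable.
by rewrite diff_lin.
Qed.

Lemma CkD V W k (U : set V) (f g : V -> W) : open U ->
  Ck k U f -> Ck k U g -> Ck k U (fun x => f x + g x).
Proof.
move=> oU; elim: k f g => [|k IH] f g /=.
  by move=> cf cg x Ux; apply: cvgD; [exact: cf|exact: cg].
move=> [df Df] [dg Dg]; split => [x Ux|v].
  by apply: (@differentiableD _ _ _ f g); [exact: df|exact: dg].
apply: Ck_ext (IH _ _ (Df v) (Dg v)) => // x Ux.
by rewrite -deriveD//; apply: diff_derivable; [exact: df|exact: dg].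
Qed.

Lemma Ck_scale V W k (U : set V) (a : V -> R) (g : V -> W) : open U ->
  Ck k U a -> Ck k U g -> Ck k U (fun x => a x *: g x).
Proof.
move=> oU; elim: k a g => [|k IH] a g.
  by move=> ca cg x Ux; apply: cvgZ; [exact: ca|exact: cg].
move=> Ca Cg; move: (Ca) (Cg) => /= [da Da] [dg Dg].
split => [x Ux|v]; first by have [] := diff_scale 0 (da x Ux) (dg x Ux).
have H := CkD oU (IH _ _ (CkW Ca) (Dg v)) (IH _ _ (Da v) (CkW Cg)).
apply: Ck_ext H => // x Ux.
have [d e] := diff_scale v (da x Ux) (dg x Ux).
by rewrite (deriveE v d) e (deriveE v (dg x Ux)) (deriveE v (da x Ux)).
Qed.

Lemma Ck_sum V W k (U : set V) n (f : 'I_n -> V -> W) : open U ->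
  (forall i, Ck k U (f i)) -> Ck k U (fun x => \sum_i f i x).
Proof.
move=> oU; elim: n f => [|n IH] f Cf.
  have -> : (fun x => \sum_(i < 0) f i x) = fun=> 0; last exact: Ck_cst.
  by apply/funext => x; rewrite big_ord0.
have -> : (fun x => \sum_(i < n.+1) f i x) =
    fun x => f ord0 x + \sum_(i < n) f (lift ord0 i) x.
  by apply/funext => x; rewrite big_ord_recl.
by apply: CkD => //; apply: IH => i.
Qed.

Lemma Ck_comp_linear V W W' k (U : set V) (f : V -> W) (l : {linear W -> W'}) :
  open U -> continuous l -> Ck k U f -> Ck k U (fun x => l (f x)).
Proof.
move=> oU cl; elim: k f => [|k IH] f /=.
  by move=> cf x Ux; apply: (@continuous_comp _ _ _ f l); [exact: cf|exact: cl].
move=> [df Df]; have dl y : differentiable l y by exact: linear_differentiable.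
have dlf x : U x -> differentiable (fun y => l (f y)) x.
  by move=> Ux; apply: (@differentiable_comp _ _ _ _ f l) => //; exact: df.
split=> // v; apply: Ck_ext (IH _ (Df v)) => // x Ux.
rewrite [RHS]deriveE; last exact: dlf.
rewrite (@diff_comp _ _ _ _ f l)//=; last exact: df.
by rewrite diff_lin// deriveE//; exact: df.
Qed.

(** Induction on [k]: the directional derivative of [g \o f] is
    [\sum_i (D_v f)_i *: (D_i g \o f)], which involves the composite [D_i g \o f]
    one order lower.  The sum over a basis is why the middle space is ['rV_n]. *)
Lemma Ck_comp V n W k (U : set V) (U' : set 'rV[R]_n) (f : V -> 'rV[R]_n)
    (g : 'rV[R]_n -> W) :
  open U -> (forall x, U x -> U' (f x)) ->
  Ck k U f -> Ck k U' g -> Ck k U (g \o f).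
Proof.
move=> oU fU; elim: k f g fU => [|k IH] f g fU.
  by move=> cf cg x Ux; apply: continuous_comp; [exact: cf|exact/cg/fU].
move=> Cf Cg; move: (Cf) (Cg) => /= [df Df] [dg Dg].
have dgf x : U x -> differentiable (g \o f) x.
  by move=> Ux; apply: differentiable_comp; [exact: df|exact/dg/fU].
split=> // v.
have H i : Ck k U (fun x => ('D_v f x) 0 i *: 'D_(delta_mx 0 i) g (f x)).
  apply: Ck_scale => //; last exact: (IH f _ fU (CkW Cf) (Dg _)).
  apply: (@Ck_comp_linear _ _ _ k U _ (rV_coord i)) => //.
  exact: coord_continuous.
apply: Ck_ext (Ck_sum oU H) => // x Ux.
rewrite [RHS]deriveE; last exact: dgf.
rewrite diff_comp//=; [|exact: df|exact/dg/fU].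
rewrite [RHS]rV_sum_delta; apply: eq_bigr => i _.
by rewrite !deriveE//; [exact/dg/fU|exact: df].
Qed.

End Calculus.

(** * The chain rule on manifolds, and changes of coordinates *)

Section Manifolds.
Context {R : realType}.
Implicit Types M N P : mfd R.

(** The part of the manifold axioms that the chain rule uses.  It holds for
    cotangent bundles and products at once, without the transition maps of these
    having to be examined. *)
Definition charted M : Prop :=
  (forall a : M, cdom a a) /\
  (forall a x : M, cdom a x -> param a (chart a x) = x).

(** The first clause keeps [f] inside the chart around [f a]; without it the
    coordinate expression of [f] would not determine [f] near [a]. *)
Definition mdifferentiable M N (f : M -> N) (a : M) : Prop :=
  (\forall u \near chart a a, cdom (f a) (f (param a u))) /\
  differentiable (chart (f a) \o f \o param a) (chart a a).

Lemma manifold_charted M : is_manifold M -> charted M.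
Proof. by case. Qed.

Lemma Cinf_differentiable (V W : normedModType R) (U : set V) (f : V -> W) x :
  Cinf U f -> U x -> differentiable f x.
Proof. by move=> /(_ 1%N)[df _] /df. Qed.

Lemma smooth_mdifferentiable M N (f : M -> N) a : smooth f -> mdifferentiable f a.
Proof.
move=> /(_ a)[U [[oU Ua _] fU Cf]]; split; last exact: Cinf_differentiable Cf Ua.
by apply: filterS (open_nbhs_nbhs (conj oU Ua)).
Qed.

Lemma smoothv_differentiable M (W : normedModType R) (f : M -> W) a :
  smoothv f -> differentiable (f \o param a) (chart a a).
Proof. by move=> /(_ a)[U [oU Ua _] Cf]; exact: Cinf_differentiable Cf Ua. Qed.

(** Stated for a vector-valued [g]: taking a chart of [N] or of a third manifold
    for [g] gives the chain rule for tangent maps, and the expression of a tangent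
    map in a chart other than the preferred one. *)
Lemma diff_dmap_comp M N (W : normedModType R) (f : M -> N) (g : N -> W) a :
  charted M -> charted N -> mdifferentiable f a ->
  differentiable (g \o param (f a)) (chart (f a) (f a)) ->
  differentiable (g \o f \o param a) (chart a a) /\
  forall v, dmap (g \o f) a v = dmap g (f a) (tmap f a v).
Proof.
move=> [cM pM] [cN pN] [nf df] dg.
have [||dh e] := near_diff_comp (h := g \o f \o param a) _ df dg _.
- by rewrite /= pM.
- by apply: filterS nf => u Hu /=; rewrite pN.
by split.
Qed.

Lemma dmap_comp M N (W : normedModType R) (f : M -> N) (g : N -> W) a v :
  charted M -> charted N -> mdifferentiable f a ->
  differentiable (g \o param (f a)) (chart (f a) (f a)) ->
  dmap (g \o f) a v = dmap g (f a) (tmap f a v).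
Proof. by move=> cM cN df dg; have [_ ->] := diff_dmap_comp cM cN df dg. Qed.

Lemma tmap_comp M N P (f : M -> N) (g : N -> P) a v :
  charted M -> charted N -> mdifferentiable f a -> mdifferentiable g (f a) ->
  tmap (g \o f) a v = tmap g (f a) (tmap f a v).
Proof.
move=> cM cN df [_ dg].
exact: (dmap_comp (g := chart (g (f a)) \o g) v cM cN df dg).
Qed.

(** The neighbourhood of [a] is cut down to the points whose image has its
    coordinates in the neighbourhood where [g] is C^oo. *)
Lemma smooth_comp M N P (f : M -> N) (g : N -> P) :
  charted M -> charted N -> smooth f -> smooth g -> smooth (g \o f).
Proof.
move=> [cM pM] [cN pN] sf sg a.
have [U [[oU Ua Uc] fU Cf]] := sf a.
have [V [[oV Va Vc] gV Cg]] := sg (f a).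
set F := chart (f a) \o f \o param a in Cf.
have cF : {in U, continuous F} by move=> u /set_mem Uu; exact: (Cf 0%N).
have oW : open (U `&` F @^-1` V).
  rewrite openE => u [Uu Vu]; apply: filterI; first exact: open_nbhs_nbhs.
  by apply: cF; [exact: mem_set|exact: open_nbhs_nbhs].
exists (U `&` F @^-1` V); split.
- by split=> // [|u [/Uc]//]; split=> //=; rewrite /F /= pM.
- by move=> u [Uu /gV]; rewrite /F /= pN//; exact: fU.
- move=> k; have C1 : Ck k (U `&` F @^-1` V) F by apply: Ck_sub (Cf k) => u [].
  apply: Ck_ext (Ck_comp oW _ C1 (Cg k)) => //; last by move=> u [].
  by move=> u [Uu _]; rewrite /F /= pN//; exact: fU.
Qed.

Lemma open_chart M (a : M) : is_manifold M -> open (chart a @` cdom a).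
Proof. by case=> _ _ /(_ a a); rewrite setIid. Qed.

Lemma near_chart2 M (a b x : M) : is_manifold M -> cdom a x -> cdom b x ->
  \forall u \near chart a x, cdom a (param a u) /\ cdom b (param a u) /\
     chart a (param a u) = u.
Proof.
move=> [cM pM oM _ _] ax bx.
have : nbhs (chart a x) (chart a @` (cdom a `&` cdom b)).
  by apply: open_nbhs_nbhs; split; [exact: oM|exists x].
by apply: filterS => u [y [ay bY] <-]; rewrite pM.
Qed.

Lemma chart_differentiable M (a b x : M) : is_manifold M ->
  cdom a x -> cdom b x -> differentiable (chart b \o param a) (chart a x).
Proof.
move=> [_ _ _ CM _] ax bx; apply: Cinf_differentiable (CM a b) _.
by exists x.
Qed.

Lemma trans_id M (a x : M) v : is_manifold M -> cdom a x -> trans a a x v = v.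
Proof.
move=> mM ax.
have E : {near chart a x, id =1 chart a \o param a}.
  by apply: filterS (near_chart2 mM ax ax) => u [_ [_ /= ->]].
have [_ e] := near_eq_diff E (@ex_diff _ _ _ _ _ _ _ (is_diff_id _)).
by rewrite /trans e diff_val.
Qed.

Lemma trans_trans M (a b c x : M) v : is_manifold M ->
  cdom a x -> cdom b x -> cdom c x -> trans b c x (trans a b x v) = trans a c x v.
Proof.
move=> mM ax bx cx; have [_ pM _ _ _] := mM.
have d1 := chart_differentiable mM ax bx.
have d2 := chart_differentiable mM bx cx.
have [||dh e] := near_diff_comp (h := chart c \o param a) _ d1 d2 _.
- by rewrite /= pM.
- by apply: filterS (near_chart2 mM ax bx) => u [_ [bu _]] /=; rewrite pM.
exact/esym/e.
Qed.

(** The left-hand side reads the vector in the chart preferred at the moving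
    point [x], the right-hand side in the fixed chart at [a]; only the latter
    can be differentiated with respect to [x]. *)
Lemma tmap_trans M N (f : M -> N) (a x : M) v : is_manifold M -> cdom a x ->
  mdifferentiable f x ->
  tmap f x (trans a x x v) = 'd (chart (f x) \o f \o param a) (chart a x) v.
Proof.
move=> mM ax [_ df]; have [cM pM _ _ _] := mM.
have d1 := chart_differentiable mM ax (cM x).
have [||_ e] := near_diff_comp (h := chart (f x) \o f \o param a) _ d1 df _.
- by rewrite /= pM.
- by apply: filterS (near_chart2 mM ax (cM x)) => u [_ [bu _]] /=; rewrite pM.
exact/esym/e.
Qed.

Lemma dotE n (p v : 'rV[R]_n) : dot p v = (p *m v^T) 0 0.
Proof. by rewrite mxE; apply: eq_bigr => i _; rewrite mxE. Qed.

Lemma dotC n (p v : 'rV[R]_n) : dot p v = dot v p.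
Proof. by apply: eq_bigr => i _; rewrite mulrC. Qed.

Fact dot_is_linear n (p : 'rV[R]_n) : linear (dot p).
Proof.
by move=> a u v; rewrite !dotE linearP /= mulmxDr -scalemxAr mxE [in LHS]mxE.
Qed.

HB.instance Definition _ n p :=
  GRing.isLinear.Build R 'rV[R]_n R *:%R (@dot R n p) (@dot_is_linear n p).

Lemma dotBl n (p p' v : 'rV[R]_n) : dot (p - p') v = dot p v - dot p' v.
Proof. by rewrite !(dotC _ v) linearB. Qed.

Lemma dot0r n (p : 'rV[R]_n) : dot p 0 = 0.
Proof. exact: linear0. Qed.

Lemma dot0l n (p : 'rV[R]_n) : dot 0 p = 0.
Proof. by rewrite dotC dot0r. Qed.

Lemma dot_delta n (p : 'rV[R]_n) i : dot p (delta_mx 0 i) = p 0 i.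
Proof.
rewrite /dot (bigD1 i)//= mxE !eqxx mulr1 big1 ?addr0// => j ji.
by rewrite mxE eqxx (negbTE ji) mulr0.
Qed.

(** The components of the transpose of [l] applied to [p], as they occur in
    [cotrans], [coAd] and [cotangent_lift]. *)
Lemma dot_row n m (p : 'rV[R]_n) (l : {linear 'rV[R]_m -> 'rV[R]_n}) v :
  dot (\row_i dot p (l (delta_mx 0 i))) v = dot p (l v).
Proof.
rewrite (rV_sum_delta l v) linear_sum; apply: eq_bigr => i _.
by rewrite mxE linearZ mulrC.
Qed.

Lemma dot_cotrans M (a b x : M) p v :
  dot (cotrans a b x p) v = dot p (trans b a x v).
Proof. exact: dot_row. Qed.

Lemma dot_inj n (p p' : 'rV[R]_n) : (forall v, dot p v = dot p' v) -> p = p'.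
Proof. by move=> h; apply/rowP => i; rewrite -!dot_delta. Qed.

(** Covectors change by the transposes of the changes of vectors, and these
    compose to the identity. *)
Lemma cotransK M (a x : M) p : is_manifold M -> cdom a x ->
  cotrans a x x (cotrans x a x p) = p /\ cotrans x a x (cotrans a x x p) = p.
Proof.
move=> mM ax; have [cM _ _ _ _] := mM.
by split; apply: dot_inj => v; rewrite !dot_cotrans trans_trans// trans_id.
Qed.

Lemma cotangent_charted M : is_manifold M -> charted (cotangent M).
Proof.
move=> mM; have [cM pM _ _ _] := mM; split=> [a|a x ax]; first exact: cM.
have ax' : cdom a.1 x.1 := ax.
rewrite /param /chart /= row_mxKl row_mxKr.
rewrite -/(param _ _) -/(chart _ _) pM//.
by have [-> _] := cotransK x.2 mM ax'; case: (x).
Qed.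

End Manifolds.

(** * Products and the cotangent projection *)

Section Products.
Context {R : realType}.
Implicit Types M N : mfd R.

Definition emb_l m n (u : 'rV[R]_m) : 'rV[R]_(m + n) := row_mx u 0.
Definition emb_r m n (v : 'rV[R]_n) : 'rV[R]_(m + n) := row_mx 0 v.

Fact emb_l_is_linear m n : linear (@emb_l m n).
Proof. by move=> a u v; rewrite /emb_l scale_row_mx add_row_mx scaler0 addr0. Qed.

Fact emb_r_is_linear m n : linear (@emb_r m n).
Proof. by move=> a u v; rewrite /emb_r scale_row_mx add_row_mx scaler0 addr0. Qed.

HB.instance Definition _ m n :=
  GRing.isLinear.Build R 'rV[R]_m 'rV[R]_(m + n) *:%R (@emb_l m n)
    (@emb_l_is_linear m n).
HB.instance Definition _ m n :=
  GRing.isLinear.Build R 'rV[R]_n 'rV[R]_(m + n) *:%R (@emb_r m n)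
    (@emb_r_is_linear m n).

Lemma row_mx_emb m n (u : 'rV[R]_m) (v : 'rV[R]_n) :
  row_mx u v = emb_l n u + emb_r m v.
Proof. by rewrite /emb_l /emb_r add_row_mx addr0 add0r. Qed.

Lemma Cinf_affine n (W : normedModType R) (U : set 'rV[R]_n)
    (l : {linear 'rV[R]_n -> W}) (c : W) (f : 'rV[R]_n -> W) :
  open U -> (forall u, U u -> f u = l u + c) -> Cinf U f.
Proof.
move=> oU fE k; apply: Ck_ext (_ : Ck k U (fun u => l u + c)) => //.
  by move=> u /fE.
apply: CkD => //; last exact: Ck_cst.
by apply: Ck_linear; exact: linear_rV_continuous.
Qed.

Lemma chart_prodE M N (a x : prod_mfd M N) :
  chart a x = row_mx (chart a.1 x.1) (chart a.2 x.2).
Proof. by []. Qed.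

Lemma param_prodE M N (a : prod_mfd M N) u v :
  param a (row_mx u v) = (param a.1 u, param a.2 v).
Proof. by rewrite {1}/param /= row_mxKl row_mxKr. Qed.

Lemma smooth_pairl M N (x : M) : is_manifold M -> is_manifold N ->
  smooth (fun y : N => (x, y) : prod_mfd M N).
Proof.
move=> mM mN b; have [cM _ _ _ _] := mM; have [cN pN _ _ _] := mN.
exists (chart b @` cdom b); split.
- by split; [exact: open_chart|exists b|].
- by move=> u [y by_ <-]; split; [exact: cM|rewrite /= pN].
- refine (@Cinf_affine _ 'rV[R]_(mdim M + mdim N) _ (@emb_r (mdim M) (mdim N))
    (emb_l _ (chart x x)) _ _ _).
    exact: open_chart.
  move=> u [y by_ <-]; rewrite addrC -row_mx_emb /=.
  by rewrite {1}/chart /= -/(chart _ _) -/(chart _ _) pN.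
Qed.

Lemma smooth_pairr M N (y : N) : is_manifold M -> is_manifold N ->
  smooth (fun x : M => (x, y) : prod_mfd M N).
Proof.
move=> mM mN a; have [cM pM _ _ _] := mM; have [cN _ _ _ _] := mN.
exists (chart a @` cdom a); split.
- by split; [exact: open_chart|exists a|].
- by move=> u [x ax <-]; split; [rewrite /= pM|exact: cN].
- refine (@Cinf_affine _ 'rV[R]_(mdim M + mdim N) _ (@emb_l (mdim M) (mdim N))
    (emb_r _ (chart y y)) _ _ _).
    exact: open_chart.
  move=> u [x ax <-]; rewrite -row_mx_emb /=.
  by rewrite {1}/chart /= -/(chart _ _) -/(chart _ _) pM.
Qed.

Lemma prod_charted M N : charted M -> charted N -> charted (prod_mfd M N).
Proof.
move=> [cM pM] [cN pN]; split=> [a|a x [ax bx]].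
  by split; [exact: cM|exact: cN].
rewrite /param /chart /= row_mxKl row_mxKr -/(param _ _) -/(chart _ _) pM//.
by rewrite -/(param _ _) -/(chart _ _) pN//; case: (x).
Qed.

Lemma smooth_cotangent_proj M : is_manifold M -> smooth (@cotangent_proj R M).
Proof.
move=> mM a; have [cM pM _ _ _] := mM.
have oU : open ((lsubmx : 'rV[R]_(mdim M + mdim M) -> 'rV_(mdim M))
    @^-1` (chart a.1 @` cdom a.1)).
  by apply: open_comp => [u _|]; [exact: continuous_lsubmx|exact: open_chart].
exists (lsubmx @^-1` (chart a.1 @` cdom a.1)); split.
- split => //; first by rewrite /= /chart /= row_mxKl; exists a.1.
  move=> u [x ax xu]; exists (x, cotrans a.1 x x (rsubmx u)) => //.
  rewrite {1}/chart /= -/(chart _ _) xu.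
  by have [_ ->] := cotransK (rsubmx u) mM ax; rewrite hsubmxK.
- by move=> u [x ax xu]; rewrite /param /= -/(param _ _) -xu pM.
- apply: (Cinf_affine (l := lsubmx) (c := 0)) => // u [x ax xu].
  by rewrite /param /= -/(param _ _) -xu pM// addr0.
Qed.

End Products.

(** * Partial derivatives and left-invariant vector fields *)

Section Partial.
Context {R : realType}.

Lemma differentiable_row_mx (V : normedModType R) m n (f : V -> 'rV[R]_m)
    (g : V -> 'rV[R]_n) x :
  differentiable f x -> differentiable g x ->
  differentiable (fun u => row_mx (f u) (g u)) x.
Proof.
move=> df dg; have -> : (fun u => row_mx (f u) (g u)) =
    (@emb_l R m n \o f) + (@emb_r R m n \o g).
  by apply/funext => u; rewrite row_mx_emb.
by apply: differentiableD; apply: differentiable_comp => //;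
  apply: linear_differentiable; exact: linear_rV_continuous.
Qed.

Lemma differentiable_row (V : normedModType R) n (f : 'I_n -> V -> R) x :
  (forall i, differentiable (f i) x) -> differentiable (fun u => \row_i f i u) x.
Proof.
move=> df; have -> : (fun u => \row_i f i u) =
    \sum_i (fun u => f i u *: (delta_mx 0 i : 'rV[R]_n)).
  apply/funext => u; rewrite fct_sumE [LHS]row_sum_delta.
  by apply: eq_bigr => i _; rewrite mxE.
by apply: differentiable_sum => i; exact: differentiableZl.
Qed.

(** A differential in the second variable at a moving point [(u, v)] is a
    directional derivative of [F] in a fixed direction, whose dependence on
    [(u, v)] is governed by the smoothness of [F]. *)
Lemma diff_partial m n (W : normedModType R) (F : 'rV[R]_(m + n) -> W) u v w :
  differentiable F (row_mx u v) ->
  'd (fun v' => F (row_mx u v')) v w = 'D_(emb_r m w) F (row_mx u v).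
Proof.
move=> dF; have dr : differentiable (@emb_r R m n) v.
  by apply: linear_differentiable; exact: linear_rV_continuous.
have dA : differentiable (fun v' : 'rV[R]_n => row_mx u v') v.
  apply: differentiable_row_mx; first exact: differentiable_cst.
  exact: (@ex_diff _ _ _ _ _ _ _ (is_diff_id v)).
have dAE : 'd (fun v' : 'rV[R]_n => row_mx u v') v w = emb_r m w.
  have -> : (fun v' : 'rV[R]_n => row_mx u v') = cst (emb_l n u) + @emb_r R m n.
    by apply/funext => v'; rewrite row_mx_emb.
  have e := diffD (differentiable_cst (emb_l n u) v) dr.
  have lc := @linear_rV_continuous R n _ (@emb_r R m n).
  have e0 := congr1 (fun h : _ -> _ => h w) (diff_cst (emb_l n u) v).
  have e1 := congr1 (fun h : _ -> _ => h w) (diff_lin v lc).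
  move: (congr1 (fun h : _ -> _ => h w) e); cbn beta => ->.
  by apply: etrans (congr2 +%R e0 e1) _; rewrite add0r.
have [||_ ->] := near_diff_comp (h := fun v' => F (row_mx u v')) _ dA dF _ => //.
  by near=> v'.
by rewrite dAE deriveE.
Unshelve. all: by end_near. Qed.

Lemma Cinf_derive (V W : normedModType R) (U : set V) (F : V -> W) w x :
  Cinf U F -> U x -> differentiable (fun y => 'D_w F y) x.
Proof. by move=> /(_ 2%N)[_ /(_ w)] /= [dF _]; exact: dF. Qed.

End Partial.

Section LeftInvariant.
Context {R : realType} (G : lie_group R) (hG : is_lie_group G).
Local Notation GG := (lg_mfd G).

Lemma smooth_lmul (g : G) : smooth (fun h : GG => (g * h)%g : GG).
Proof.
have [mG sm _] := hG; have cG := manifold_charted mG.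
have sp := smooth_pairl (g : GG) mG mG.
exact: (smooth_comp cG (prod_charted cG cG) sp sm).
Qed.

(** In the chart at the unit the field is [u |-> 'D_(0, xi) F (u, c1)], where [F]
    is the multiplication in coordinates and [c1] the coordinates of the unit. *)
Lemma vf_rep_left_inv_differentiable (xi : lie_alg G) :
  differentiable (vf_rep (left_inv xi) (1%g : GG)) (chart (1%g : GG) (1%g : GG)).
Proof.
have [mG sm _] := hG; have [cG pG _ _ _] := mG; have hc := manifold_charted mG.
set c1 := chart _ _.
have [U [[oU Ua Uc] UF CF]] := sm ((1, 1)%g).
set F := (_ \o _ \o _) in CF.
have UcE : U (row_mx c1 c1) := Ua.
have dr : differentiable (fun u : 'rV[R]_(mdim GG) => row_mx u c1) c1.
  apply: differentiable_row_mx; last exact: differentiable_cst.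
  exact: (@ex_diff _ _ _ _ _ _ _ (is_diff_id c1)).
have dD := Cinf_derive (emb_r _ xi) CF UcE.
have nU : \forall u \near c1, U (row_mx u c1).
  exact: (differentiable_continuous dr) (open_nbhs_nbhs (conj oU UcE)).
have [||//] := near_diff_comp (h := vf_rep (left_inv xi) (1%g : GG)) _ dr dD _.
  by [].
apply: filterS nU => u Uu /=.
have [[x y] [/= x1 y1]] := Uc _ Uu.
rewrite chart_prodE => /eq_row_mx[ux _].
have pu : param (1%g : GG) u = x by rewrite -ux pG.
rewrite /vf_rep pu /left_inv.
have := UF _ Uu.
rewrite param_prodE pu pG// !mulg1 => x1'.
have dF : differentiable F (row_mx u c1) by exact: Cinf_differentiable CF Uu.
rewrite -diff_partial//.
have -> : (fun v' => F (row_mx u v')) =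
    chart (1%g : GG) \o (fun h : GG => (x * h)%g : GG) \o param (1%g : GG).
  by apply/funext => v; rewrite /F /comp param_prodE /= mulg1 pu.
have dx : mdifferentiable (fun h : GG => (x * h)%g : GG) (1%g : GG).
  by apply: smooth_mdifferentiable; exact: smooth_lmul.
have dc : differentiable (chart (1%g : GG) \o param (x * 1 : GG)%g)
    (chart (x * 1 : GG)%g (x * 1 : GG)%g).
  by rewrite mulg1; exact: chart_differentiable.
have := dmap_comp (g := chart (1%g : GG)) xi hc hc dx dc.
by rewrite mulg1.
Qed.

(** [bracket] differentiates its first argument, and the differential of a
    difference splits only for differentiable fields. *)
Lemma lie_bracketBl (x1 x2 eta : lie_alg G) :
  lie_bracket (x1 - x2) eta = lie_bracket x1 eta - lie_bracket x2 eta.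
Proof.
have E g : left_inv (x1 - x2) g = left_inv x1 g - left_inv x2 g by exact: linearB.
rewrite /lie_bracket /bracket E.
have -> : vf_rep (left_inv (x1 - x2)) (1%g : GG) =
    vf_rep (left_inv x1) (1%g : GG) - vf_rep (left_inv x2) (1%g : GG).
  by apply/funext => u; rewrite /vf_rep E; exact: (linearB ('d _ _)).
have d1 := vf_rep_left_inv_differentiable x1.
have d2 := vf_rep_left_inv_differentiable x2.
have e0 := diffB d1 d2.
have e := congr1 (fun h : tvec GG -> tvec GG => h (left_inv eta (1%g : GG))) e0.
have eY := linearB
  ('d (vf_rep (left_inv eta) (1%g : GG)) (chart (1%g : GG) (1%g : GG)))
  (left_inv x1 (1%g : GG)) (left_inv x2 (1%g : GG)).
apply: etrans (congr2 (fun a b : tvec GG => a - b) eY e) _.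
exact: subrACA.
Qed.

End LeftInvariant.

(** * The cotangent lift of an action *)

Section Lift.
Context {R : realType} (G : lie_group R) (hG : is_lie_group G).
Context (Q : mfd R) (hQ : is_manifold Q).
Context (act : G -> Q -> Q) (hact : smooth_left_action act).
Local Notation GG := (lg_mfd G).

Lemma smooth_act g : smooth (act g).
Proof.
have [_ _ sa] := hact; have [mG _ _] := hG.
have cG := manifold_charted mG; have cQ := manifold_charted hQ.
exact: (smooth_comp cQ (prod_charted cG cQ) (smooth_pairl (g : GG) mG hQ) sa).
Qed.

Lemma smooth_orbit_map q : smooth (fun g : GG => act g q).
Proof.
have [_ _ sa] := hact; have [mG _ _] := hG.
have cG := manifold_charted mG; have cQ := manifold_charted hQ.
exact: (smooth_comp cG (prod_charted cG cQ) (smooth_pairr q mG hQ) sa).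
Qed.

Lemma actK g q : act g^-1%g (act g q) = q.
Proof. by have [a1 aM _] := hact; rewrite -aM mulVg a1. Qed.

Lemma dot_cotangent_lift g (z : cotangent Q) v :
  dot (cotangent_lift act g z).2 v = dot z.2 (tmap (act g^-1%g) (act g z.1) v).
Proof. exact: (@dot_row R _ _ z.2 (tmap (act g^-1%g) (act g z.1))). Qed.

Lemma tmap_id (M : mfd R) (a : M) v : is_manifold M -> tmap (id : M -> M) a v = v.
Proof. by move=> mM; apply: trans_id => //; have [] := mM. Qed.

Lemma cotangent_lift1 z : cotangent_lift act 1%g z = z.
Proof.
have [a1 _ _] := hact; have aid : act 1%g = id by exact/funext.
have e2 : (cotangent_lift act 1%g z).2 = z.2.
  apply: dot_inj => v; apply: etrans (dot_cotangent_lift 1%g z v) _.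
  by rewrite invg1 aid tmap_id.
rewrite [RHS](surjective_pairing z).
by rewrite [LHS](surjective_pairing (cotangent_lift _ _ _)) e2 /= a1.
Qed.

(** In canonical coordinates the base part of [g . z] is [g . q], and the [i]-th
    component of the covector part pairs that of [z] with the partial derivative
    in the direction [e_i] of the action [F] in coordinates, taken at
    [(g^-1, g . q)]. *)
Lemma lift_orbit_map_mdifferentiable z :
  mdifferentiable (fun g : GG => cotangent_lift act g z : cotangent Q) (1%g : GG).
Proof.
have [a1 aM sa] := hact; have [mG _ sV] := hG.
have [cG pG _ _ _] := mG; have [cQ pQ _ _ _] := hQ.
have so := smooth_orbit_map z.1.
have [no do_] := smooth_mdifferentiable (1%g : GG) so.
have [nV dV] := smooth_mdifferentiable (1%g : GG) sV.
rewrite /= a1 in no do_; rewrite /= invg1 in nV dV.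
rewrite /mdifferentiable cotangent_lift1; split; first exact: no.
set q := z.1 in so no do_ *.
set c1 := chart _ _ in no do_ nV dV *.
have [U [[oU Ua Uc] UF CF]] := sa (1%g, q).
set F := (_ \o _ \o _) in CF.
have UcE : U (row_mx c1 (chart q q)) := Ua.
(* the coordinates of [(g^-1, g . q)] *)
pose psi u := row_mx (chart (1%g : GG) ((param (1%g : GG) u)^-1 : GG)%g)
                     (chart q (act (param (1%g : GG) u) q)).
have psi1 : psi c1 = row_mx c1 (chart q q) by rewrite /psi pG// invg1 a1.
have dpsi : differentiable psi c1 by exact: differentiable_row_mx.
have nU : \forall u \near c1, U (psi u).
  apply: (differentiable_continuous dpsi); rewrite psi1.
  exact: open_nbhs_nbhs.
pose Psi u := row_mx (chart q (act (param (1%g : GG) u) q))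
   (\row_i \sum_j z.2 0 j * ('D_(emb_r (mdim GG) (delta_mx 0 i)) F (psi u)) 0 j).
have dPsi : differentiable Psi c1.
  apply: differentiable_row_mx => //; apply: differentiable_row => i.
  pose w : 'rV[R]_(mdim GG + mdim Q) := emb_r (mdim GG) (delta_mx 0 i).
  have dD : differentiable (fun y => 'D_w F y) (psi c1).
    by rewrite psi1; exact: Cinf_derive CF UcE.
  have dl : differentiable (dot z.2) ('D_w F (psi c1)).
    by apply: linear_differentiable; exact: linear_rV_continuous.
  have dDp := differentiable_comp dpsi dD.
  exact: (differentiable_comp dDp dl).
have [|//] := near_eq_diff (g := chart z \o
   (fun g : GG => cotangent_lift act g z : cotangent Q) \o
   param (1%g : GG)) _ dPsi.
near=> u.
have qx : cdom q (act (param (1%g : GG) u) q) by near: u.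
have g1 : cdom (1%g : GG) ((param (1%g : GG) u)^-1 : GG)%g by near: u.
have Uu : U (psi u) by near: u.
set g := param (1%g : GG) u in qx g1 *.
rewrite /Psi /= -/g {2}/chart /= -/q -/(chart _ _); congr row_mx.
apply/rowP => i; rewrite mxE -[RHS]dot_delta dot_cotrans.
rewrite (dot_cotangent_lift g z) -/q.
have dF : differentiable F (psi u) by exact: Cinf_differentiable CF Uu.
rewrite -/(dot _ _); congr (dot _ _).
have dg : mdifferentiable (act (g^-1)%g) (act g q).
  by apply: smooth_mdifferentiable; exact: smooth_act.
rewrite (tmap_trans (delta_mx 0 i) hQ qx dg).
have E : (fun v' => F (row_mx (chart (1%g : GG) (g^-1 : GG)%g) v')) =
    chart (act g^-1%g (act g q)) \o act g^-1%g \o param q.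
  by apply/funext => v; rewrite /F /comp param_prodE /= a1 pG// actK.
apply: etrans (esym (diff_partial (delta_mx 0 i) dF)) _.
exact: (congr1 (fun h : _ -> tvec Q =>
  'd h (chart q (act g q)) (delta_mx 0 i)) E).
Unshelve. all: by end_near. Qed.

End Lift.

(** * Symplectic maps, conservation of momentum, and reduction *)

Section Symplectic.
Context {R : realType} (Q : mfd R).

(** Equality of dimensions, through the invertibility of the matrix of [l]. *)
Lemma inj_linear_surj n (l : {linear 'rV[R]_n -> 'rV[R]_n}) :
  (forall v, l v = 0 -> v = 0) -> forall w, exists v, l v = w.
Proof.
move=> inj w; have rf : row_free (lin1_mx l).
  by apply: inj_row_free => v; rewrite mul_rV_lin1 => /inj.
exists (w *m invmx (lin1_mx l)).
by rewrite -mul_rV_lin1 mulmxKV// -row_free_unit.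
Qed.

Implicit Types (z : cotangent Q) (v w : 'rV[R]_(mdim Q + mdim Q)).

Lemma omegaC z v w : omega z v w = - omega z w v.
Proof. by rewrite /omega opprB. Qed.

Lemma omegaBl z v1 v2 w : omega z (v1 - v2) w = omega z v1 w - omega z v2 w.
Proof.
rewrite /omega [lsubmx (v1 - v2)]linearB [rsubmx (v1 - v2)]linearB.
rewrite [dot (lsubmx w) _]linearB dotBl; exact: subrACA.
Qed.

Lemma omega_nondegenerate z v : (forall w, omega z v w = 0) -> v = 0.
Proof.
move=> h; rewrite -[v]hsubmxK; have -> : lsubmx v = 0.
  apply: dot_inj => w; have := h (row_mx 0 w).
  rewrite /omega row_mxKr row_mxKl !dot0l subr0.
  exact.
have -> : rsubmx v = 0; last by rewrite row_mx0.
apply: dot_inj => w; have := h (row_mx w 0).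
rewrite /omega row_mxKr row_mxKl dot0r sub0r => /eqP.
by rewrite oppr_eq0 dotC dot0l => /eqP.
Qed.

Lemma symplectic_map_tmap_surj (f : cotangent Q -> cotangent Q) z w :
  symplectic_map f -> exists v, tmap f z v = w.
Proof.
move=> [_ sf]; apply: inj_linear_surj => v v0.
have {}v0 : tmap f z v = 0 by exact: v0.
apply: (@omega_nondegenerate z) => u; rewrite -sf v0.
by rewrite -[X in omega _ X _](subrr 0) omegaBl subrr.
Qed.

(** Both sides pair in the same way, under the symplectic form, with all vectors
    [T f v], and these are all the vectors at [f z]. *)
Lemma symplectic_map_vfield (f : cotangent Q -> cotangent Q)
    (H : cotangent Q -> R) (X Y : vfield (cotangent Q)) z :
  is_manifold Q -> symplectic_map f -> smoothv H ->
  hamiltonian_vfield H X -> hamiltonian_vfield (H \o f) Y ->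
  tmap f z (Y z) = X (f z).
Proof.
move=> mQ sf sH hX hY; have [smf omf] := sf.
have cQ := cotangent_charted mQ.
apply/subr0_eq/(@omega_nondegenerate (f z)) => w.
have [v <-] := symplectic_map_tmap_surj z w sf.
rewrite omegaBl omf hY hX.
rewrite (dmap_comp _ cQ cQ (smooth_mdifferentiable z smf)) ?subrr//.
exact: smoothv_differentiable.
Qed.

End Symplectic.

Section Momentum.
Context {R : realType} (G : lie_group R) (hG : is_lie_group G).
Context (Q : mfd R) (hQ : is_manifold Q).
Context (act : G -> Q -> Q) (hact : smooth_left_action act).
Context (J : cotangent Q -> lie_dual G).
Context (hJ : momentum_map (cotangent_lift act) J).
Local Notation GG := (lg_mfd G).

Lemma dmap_dot (M : mfd R) n (f : M -> 'rV[R]_n) (xi : 'rV[R]_n) a v :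
  differentiable (f \o param a) (chart a a) ->
  dmap (fun x => dot (f x) xi) a v = dot (dmap f a v) xi.
Proof.
move=> df.
have dl : differentiable (dot xi) ((f \o param a) (chart a a)).
  by apply: linear_differentiable; exact: linear_rV_continuous.
have [|_ e] := near_diff_comp (h := (fun x => dot (f x) xi) \o param a)
  (erefl _) df dl.
  by near=> u; rewrite /= dotC.
apply: etrans (e v) _.
have lc := @linear_rV_continuous R n _ (dot xi).
apply: etrans (congr1 (fun h : _ -> _ => h _) (diff_lin _ lc)) _.
exact: dotC.
Unshelve. all: by end_near. Qed.

(** Noether's theorem.  The derivative of the component of [J] along [xi] in the
    direction [X] is, up to sign, the derivative of [f] along the generator of
    [xi], that is along an orbit of the group, where [f] is constant. *)
Lemma momentum_conserved (f : cotangent Q -> R) (X : vfield (cotangent Q)) z :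
  differentiable (f \o param z) (chart z z) ->
  (forall g z', f (cotangent_lift act g z') = f z') ->
  hamiltonian_vfield f X -> dmap J z (X z) = 0.
Proof.
move=> df finv hX; have [sJ hgen] := hJ.
have [mG _ _] := hG.
have cG := manifold_charted mG; have cQ := cotangent_charted hQ.
apply: dot_inj => xi.
rewrite -dmap_dot; last exact: smoothv_differentiable.
rewrite -hgen omegaC hX dot0l /generator.
have dl := lift_orbit_map_mdifferentiable hG hQ hact z.
have l1 := cotangent_lift1 hQ hact z.
have := dmap_comp (g := f) xi cG cQ dl; rewrite l1 => /(_ df) <-.
have -> : f \o (fun g : GG => cotangent_lift act g z : cotangent Q) = cst (f z).
  by apply/funext => g; exact: finv.
apply/eqP; rewrite oppr_eq0; apply/eqP.
exact: (congr1 (fun h : _ -> R => h xi)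
  (diff_cst (f z) (chart (1%g : GG) (1%g : GG)))).
Qed.

End Momentum.

Section OrbitReduction.
Context {R : realType} (G : lie_group R) (hG : is_lie_group G).

Lemma orbit_form0l (mu nu : lie_dual G) op c : orbit_form mu op ->
  coadjoint_orbit mu nu -> orbit_tangent nu c -> op nu 0 c = 0.
Proof.
move=> hop onu [eta _ <-].
have <- : coad_generator 0 nu = 0 by exact: linear0.
rewrite hop//; have := lie_bracketBl hG 0 0 eta; rewrite !subrr => ->.
exact: dot0r.
Qed.

Lemma orbit_formBl (mu nu : lie_dual G) op a b c : orbit_form mu op ->
  coadjoint_orbit mu nu -> orbit_tangent nu a -> orbit_tangent nu b ->
  orbit_tangent nu c -> op nu (a - b) c = op nu a c - op nu b c.
Proof.
move=> hop onu [x1 _ <-] [x2 _ <-] [eta _ <-].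
have <- : coad_generator (x1 - x2) nu =
    coad_generator x1 nu - coad_generator x2 nu.
  exact: linearB.
by rewrite !hop// lie_bracketBl// linearB.
Qed.

Context (Q : mfd R) (hQ : is_manifold Q).
Context (J : cotangent Q -> lie_dual G) (hJ : smoothv J) (mu : lie_dual G).
Context (N : mfd R) (iN : N -> cotangent Q) (hN : orbit_level J mu iN).
Context (act : G -> cotangent Q -> cotangent Q) (B : mfd R) (piO : N -> B).
Context (hB : orbit_quotient act iN piO).
Context (omegap : lie_dual G -> lie_dual G -> lie_dual G -> R).
Context (homegap : orbit_form mu omegap).
Context (omegaO : B -> 'rV[R]_(mdim B) -> 'rV[R]_(mdim B) -> R).
Context (homegaO : reduced_form J omegap iN piO omegaO).

Let mN : is_manifold N. Proof. by have [[? _ _ _ _] _] := hN. Qed.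
Let sN : smooth iN. Proof. by have [[_ [? _] _ _ _] _] := hN. Qed.

Lemma orbit_level_mem x : coadjoint_orbit mu (J (iN x)).
Proof.
have [[_ _ _ rN _] _] := hN; have : range iN (iN x) by exists x.
by rewrite rN.
Qed.

Lemma dmapJ_iN x v : dmap (J \o iN) x v = dmap J (iN x) (tmap iN x v).
Proof.
apply: dmap_comp; [exact: manifold_charted|exact: cotangent_charted| |].
  exact: smooth_mdifferentiable.
exact: smoothv_differentiable.
Qed.

Lemma orbit_level_tangent x v : orbit_tangent (J (iN x)) (dmap (J \o iN) x v).
Proof.
have [_ /(_ x) e] := hN; rewrite dmapJ_iN.
have : tangent_space iN x (tmap iN x v) by exists v.
by rewrite e.
Qed.

(** Vectors of the quotient lift to [N] by submersivity; the identity that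
    characterizes the reduced form carries over additivity from the canonical form
    and from the orbit form. *)
Lemma reduced_formBl b v1 v2 w :
  omegaO b (v1 - v2) w = omegaO b v1 w - omegaO b v2 w.
Proof.
have [_ [_ sub] sur _] := hB.
have [x _ <-] : range piO b by rewrite sur.
have [u1 <-] := sub x v1; have [u2 <-] := sub x v2; have [u3 <-] := sub x w.
have e : tmap piO x u1 - tmap piO x u2 = tmap piO x (u1 - u2).
  exact/esym/linearB.
rewrite e.
have := homegaO x (u1 - u2) u3; have := homegaO x u1 u3; have := homegaO x u2 u3.
have -> : tmap iN x (u1 - u2) = tmap iN x u1 - tmap iN x u2 by exact: linearB.
have -> : dmap (J \o iN) x (u1 - u2) = dmap (J \o iN) x u1 - dmap (J \o iN) x u2.
  exact: linearB.
rewrite omegaBl (orbit_formBl homegap); try exact: orbit_level_tangent.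
  by move=> -> -> h; apply: (addIr (omegap (J (iN x)) (dmap (J \o iN) x u1)
     (dmap (J \o iN) x u3) - omegap (J (iN x)) (dmap (J \o iN) x u2)
     (dmap (J \o iN) x u3))); rewrite -h opprD addrACA.
exact: orbit_level_mem.
Qed.

(** The zero vector is tangent to the coadjoint orbit, so the kernel of [T J] is
    tangent to its preimage. *)
Lemma restr_orbit_level x v : dmap J (iN x) v = 0 ->
  tmap iN x (restr iN x v) = v.
Proof.
move=> v0; have [_ /(_ x) e] := hN.
have [u _ uv] : tangent_space iN x v.
  by rewrite e /= v0; exists 0 => //; exact: linear0.
exact: (@xgetPex _ 0 [set u' | tmap iN x u' = v] (ex_intro _ u uv)).
Qed.

(** Reduced dynamics: as [T J] kills [X], the orbit term drops out and the reduced
    form takes on the projected vectors the value of the canonical form. *)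
Lemma reduced_hamiltonian (H : cotangent Q -> R) (X : vfield (cotangent Q))
    (h : B -> R) x u w :
  smoothv H -> smoothv h -> (forall y, h (piO y) = H (iN y)) ->
  hamiltonian_vfield H X -> dmap J (iN x) (X (iN x)) = 0 ->
  tmap iN x u = X (iN x) ->
  omegaO (piO x) (tmap piO x u) w = dmap h (piO x) w.
Proof.
move=> sH sh hH hX JX uX.
have [mB [sp sub] _ _] := hB.
have cN := manifold_charted mN.
have [v <-] := sub x w.
have := homegaO x u v; rewrite [X in omegap _ X]dmapJ_iN uX JX.
rewrite (orbit_form0l homegap) ?addr0; last 2 first.
- exact: orbit_level_mem.
- exact: orbit_level_tangent.
move=> <-; rewrite hX.
rewrite -(dmap_comp _ cN (cotangent_charted hQ)); last 2 first.
- exact: smooth_mdifferentiable.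
- exact: smoothv_differentiable.
rewrite -(dmap_comp _ cN (manifold_charted mB)); last 2 first.
- exact: smooth_mdifferentiable.
- exact: smoothv_differentiable.
by have -> : h \o piO = H \o iN by exact/funext.
Qed.

End OrbitReduction.

Section Projection.
Context {R : realType}.

Lemma reduced_KB (Q N B C S : mfd R) (D : Q -> {vspace 'rV[R]_(mdim Q)})
    (iN : N -> cotangent Q) (piO : N -> B) (jC : C -> N) (piS : C -> S)
    (jO : S -> B) y k u v :
  subspace_dim (reduced_dist D iN piO jC piS y) k ->
  reduced_K D iN piO jC piS jO y u -> reduced_K D iN piO jC piS jO y v ->
  reduced_K D iN piO jC piS jO y (u - v).
Proof.
move=> [V VE _]; rewrite /reduced_K /=.
have -> : tmap jO y (u - v) = tmap jO y u - tmap jO y v by exact: linearB.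
by rewrite VE /=; exact: rpredB.
Qed.

(** [w] and its projection pair in the same way with [K], so the projection
    satisfies the equation on [K] that determines [X]. *)
Lemma projected_hamiltonian_vector (B S : mfd R) (jO : S -> B)
    (form : B -> 'rV[R]_(mdim B) -> 'rV[R]_(mdim B) -> R)
    (K : forall y : S, set 'rV[R]_(mdim S)) (tau : forall y : S, _)
    (h : B -> R) (X : vfield S) y w :
  charted B -> charted S -> smooth jO -> smoothv h ->
  (forall a b c, form (jO y) (a - b) c = form (jO y) a c - form (jO y) b c) ->
  (forall u v, K y u -> K y v -> K y (u - v)) ->
  K y `&` symp_orth (pullback_form jO form y) (K y) = [set 0] ->
  distributional_vfield K (pullback_form jO form) (h \o jO) X ->
  projection_along_orth jO form K tau ->
  (forall v, form (jO y) w v = dmap h (jO y) v) ->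
  tau y w = X y.
Proof.
move=> cB cS sj sh bl KB Knd hX htau wE.
have [Ktau orth] := htau y w; have [KX XE] := hX y.
apply/subr0_eq; suff : [set 0] (tau y w - X y) by [].
rewrite -Knd; split => [|v Kv]; first exact: KB.
rewrite /pullback_form.
have -> : tmap jO y (tau y w - X y) = tmap jO y (tau y w) - tmap jO y (X y).
  exact: linearB.
have e1 : form (jO y) (tmap jO y (tau y w)) (tmap jO y v) =
    dmap h (jO y) (tmap jO y v).
  have := orth (tmap jO y v); rewrite bl wE => o.
  exact/esym/subr0_eq/o/(ex_intro2 _ _ v Kv erefl).
have e2 : form (jO y) (tmap jO y (X y)) (tmap jO y v) = dmap (h \o jO) y v.
  exact: XE.
rewrite bl e1 e2 (dmap_comp _ cS cB) ?subrr//.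
  exact: smooth_mdifferentiable.
exact: smoothv_differentiable.
Qed.

End Projection.

(** * The Hamilton-Jacobi equivalence *)

Unset Implicit Arguments.
Set Strict Implicit.

Theorem theorem5p10
  (R : realType)
  (* configuration manifold, Lagrangian, Hamiltonian, distribution *)
  (Q : mfd R) (hQ : is_manifold Q)
  (L : tangent Q -> R) (hL : smoothv L) (hreg : hyperregular L)
  (H : cotangent Q -> R) (hH : hamiltonian_of L H)
  (D : Q -> {vspace 'rV[R]_(mdim Q)}) (k : nat) (hD : subbundle D k)
  (hDnh : completely_nonholonomic D) (hDreg : D_regular L D)
  (* the constraint submanifold and the distribution along it *)
  (M : mfd R) (iM : M -> cotangent Q)
  (hM : submanifold iM (constraint_set L D))
  (hMF : forall y : M,
      subspace_dim (constraint_dist D (iM y)) (mdim M))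
  (hMFperp : forall y : M,
      tangent_space iM y `&`
      symp_orth (omega (iM y)) (constraint_dist D (iM y)) = [set 0])
  (* symmetry and momentum map *)
  (G : lie_group R) (hG : is_lie_group G)
  (act : G -> Q -> Q) (hact : smooth_left_action act)
  (hfree : free_action (cotangent_lift act))
  (hproper : proper_action (cotangent_lift act))
  (hsymp : forall g : G, symplectic_map (cotangent_lift act g))
  (J : cotangent Q -> lie_dual G)
  (hJ : momentum_map (cotangent_lift act) J)
  (hJeq : equivariant (cotangent_lift act) J)
  (hHinv : forall (g : G) z, H (cotangent_lift act g z) = H z)
  (hDinv : forall (g : G) q,
      tmap (act g) q @` [set` D q] = [set` D (act g q)])
  (hMinv : forall (g : G) z,
      constraint_set L D z -> constraint_set L D (cotangent_lift act g z))
  (* regular orbit reduction *)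
  (mu : lie_dual G) (hmu : regular_value J mu)
  (N : mfd R) (iN : N -> cotangent Q) (hN : orbit_level J mu iN)
  (B : mfd R) (piO : N -> B)
  (hB : orbit_quotient (cotangent_lift act) iN piO)
  (omegap : lie_dual G -> lie_dual G -> lie_dual G -> R)
  (homegap : orbit_form mu omegap)
  (omegaO : B -> 'rV[R]_(mdim B) -> 'rV[R]_(mdim B) -> R)
  (homegaO : reduced_form J omegap iN piO omegaO)
  (ham : B -> R) (hham : smoothv ham)
  (hhamH : forall x : N, ham (piO x) = H (iN x))
  (* the reduced constraint manifold MO and the reduced system *)
  (hne : constraint_set L D `&` (J @^-1` coadjoint_orbit mu) !=set0)
  (C : mfd R) (jC : C -> N) (hC : clean_intersection iN iM jC)
  (MO : mfd R) (jO : MO -> B) (hS : submanifold jO (range (piO \o jC)))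
  (piMO : C -> MO) (hpiMO : submersion piMO)
  (hpiMOeq : forall c : C, jO (piMO c) = piO (jC c))
  (hSF : forall y : MO,
      subspace_dim (reduced_dist D iN piO jC piMO y) (mdim MO))
  (hSFperp : forall y : MO,
      tangent_space jO y `&`
      symp_orth (omegaO (jO y)) (reduced_dist D iN piO jC piMO y) = [set 0])
  (hKnd : forall y : MO,
      reduced_K D iN piO jC piMO jO y `&`
      symp_orth (pullback_form jO omegaO y)
                (reduced_K D iN piO jC piMO jO y) = [set 0])
  (XK : vfield MO)
  (hXK : distributional_vfield (reduced_K D iN piO jC piMO jO)
           (pullback_form jO omegaO) (ham \o jO) XK)
  (tau : forall y : MO, 'rV[R]_(mdim B) -> 'rV[R]_(mdim MO))
  (htau : projection_along_orth jO omegaO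
            (reduced_K D iN piO jC piMO jO) tau)
  (* the one-form, with its corestriction to N and the maps it induces *)
  (gamma : Q -> cotangent Q) (hgamma : one_form gamma)
  (hgammaMN : range gamma `<=`
      constraint_set L D `&` (J @^-1` coadjoint_orbit mu))
  (hgammainv : forall (g : G) z,
      range gamma z -> range gamma (cotangent_lift act g z))
  (gammaN : Q -> N) (hgammaN : forall q, iN (gammaN q) = gamma q)
  (gammabar : Q -> MO)
  (hgammabar : forall q, jO (gammabar q) = piO (gammaN q))
  (hgammaK : forall q v,
      reduced_K D iN piO jC piMO jO (gammabar q) (tmap gammabar q v))
  (lambdaN : N -> N)
  (hlambdaN : forall x, iN (lambdaN x) = gamma (cotangent_proj (iN x)))
  (lambdabar : N -> MO)
  (hlambdabar : forall x, jO (lambdabar x) = piO (lambdaN x))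
  (* the symplectic map, with its restriction to N and the map it induces *)
  (eps : cotangent Q -> cotangent Q) (heps : symplectic_map eps)
  (hepsinv : forall (g : G) z,
      eps (cotangent_lift act g z) = cotangent_lift act g (eps z))
  (hepsN : eps @` (J @^-1` coadjoint_orbit mu) `<=`
      J @^-1` coadjoint_orbit mu)
  (epsN : N -> N) (hepsNi : forall x, iN (epsN x) = eps (iN x))
  (epsbar : N -> MO) (hepsbar : forall x, jO (epsbar x) = piO (epsN x))
  (* X_H and the Hamiltonian vector field of H o eps on the cotangent bundle *)
  (XH : vfield (cotangent Q)) (hXH : hamiltonian_vfield H XH)
  (XHeps : vfield (cotangent Q))
  (hXHeps : hamiltonian_vfield (H \o eps) XHeps) :
  (forall x : N,
     (epsbar x,
      tau (epsbar x)
        (tmap jO (epsbar x)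
          (tmap epsbar x (restr iN x (XHeps (iN x)))))) =
     (lambdabar (epsN x),
      tmap lambdabar (epsN x) (restr iN (epsN x) (XH (eps (iN x))))))
  <->
  (forall x : N,
     let z := eps (iN x) in
     (gammabar (cotangent_proj z),
      tmap gammabar (cotangent_proj z)
        (tmap (@cotangent_proj R Q) z (XH z))) =
     (epsbar x, XK (epsbar x))).
Proof.
have [[mN [sN _] iNinj _ univN] _] := hN.
have [mB [spiO subpiO] _ _] := hB.
have [mMO [sjO _] jOinj _ univMO] := hS.
have [sgamma _] := hgamma; have [seps _] := heps.
have [sH _] := hH; have [sJ _] := hJ.
have cQ := manifold_charted hQ; have cT := cotangent_charted hQ.
have cN := manifold_charted mN; have cB := manifold_charted mB.
have cMO := manifold_charted mMO.
have sproj := smooth_cotangent_proj hQ.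
(* The induced maps are smooth because their composites with the inclusions of
   initial submanifolds are. *)
have sgammaN : smooth gammaN.
  apply: (univN _ gammaN hQ).
  by have -> : iN \o gammaN = gamma by exact/funext.
have sgammabar : smooth gammabar.
  apply: (univMO _ gammabar hQ).
  have -> : jO \o gammabar = piO \o gammaN by exact/funext.
  exact: smooth_comp.
have sepsN : smooth epsN.
  apply: (univN _ epsN mN).
  have -> : iN \o epsN = eps \o iN by exact/funext.
  exact: smooth_comp.
have sepsbar : smooth epsbar.
  apply: (univMO _ epsbar mN).
  have -> : jO \o epsbar = piO \o epsN by exact/funext.
  exact: smooth_comp.
have dHeps z : differentiable ((H \o eps) \o param z) (chart z z).
  have dH := smoothv_differentiable (eps z) sH.
  by have [] := diff_dmap_comp cT cT (smooth_mdifferentiable z seps) dH.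
have JXH z : dmap J z (XH z) = 0.
  apply: (momentum_conserved hG hQ hact hJ _ hHinv hXH).
  exact: smoothv_differentiable.
have JXHeps z : dmap J z (XHeps z) = 0.
  apply: (momentum_conserved hG hQ hact hJ (dHeps z) _ hXHeps).
  by move=> g z' /=; rewrite hepsinv hHinv.
(* The field of [H \o eps] is carried by [eps] to that of [H], which projects to
   the Hamiltonian vector of [ham] on the quotient. *)
have tauE x : tau (epsbar x) (tmap jO (epsbar x)
    (tmap epsbar x (restr iN x (XHeps (iN x))))) = XK (epsbar x).
  set u := restr iN x (XHeps (iN x)); set y := epsbar x.
  have uE : tmap iN x u = XHeps (iN x) by exact: (restr_orbit_level hN).
  have pushE : tmap iN (epsN x) (tmap epsN x u) = XH (iN (epsN x)).
    rewrite -(tmap_comp _ cN cN); try exact: smooth_mdifferentiable.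
    have -> : iN \o epsN = eps \o iN by exact/funext.
    rewrite (tmap_comp _ cN cT); try exact: smooth_mdifferentiable.
    rewrite uE hepsNi.
    exact: (symplectic_map_vfield _ hQ heps sH hXH hXHeps).
  have jE : tmap jO y (tmap epsbar x u) = tmap piO (epsN x) (tmap epsN x u).
    rewrite -(tmap_comp _ cN cMO); try exact: smooth_mdifferentiable.
    have -> : jO \o epsbar = piO \o epsN by exact/funext.
    by rewrite (tmap_comp _ cN cN); try exact: smooth_mdifferentiable.
  apply: (projected_hamiltonian_vector cB cMO sjO hham _ _ (hKnd y) hXK htau).
  - exact: (reduced_formBl hG hQ sJ hN hB homegap homegaO).
  - by move=> u1 u2; exact: (reduced_KB (hSF y)).
  - move=> v; rewrite jE hepsbar.
    exact: (reduced_hamiltonian hG hQ sJ hN hB homegap homegaO _ sH hham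
              hhamH hXH (JXH _) pushE).
have lamE : lambdabar = gammabar \o (@cotangent_proj R Q \o iN).
  apply/funext => x; apply: jOinj; rewrite hlambdabar hgammabar; congr piO.
  by apply: iNinj; rewrite hlambdaN hgammaN.
have lamT x : tmap lambdabar (epsN x) (restr iN (epsN x) (XH (eps (iN x)))) =
    tmap gammabar (cotangent_proj (eps (iN x)))
      (tmap (@cotangent_proj R Q) (eps (iN x)) (XH (eps (iN x)))).
  rewrite lamE -hepsNi (tmap_comp _ cN cQ); last 2 first.
  - by apply: smooth_mdifferentiable; exact: smooth_comp.
  - exact: smooth_mdifferentiable.
  rewrite (tmap_comp _ cN cT); try exact: smooth_mdifferentiable.
  by rewrite (restr_orbit_level hN).
have lam0 x : lambdabar (epsN x) = gammabar (cotangent_proj (eps (iN x))).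
  by rewrite lamE /= hepsNi.
by split=> h x; have := h x; rewrite tauE lamT lam0.
Qed.
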